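(* Let $n\ge 2$, $W=S_n$, let $1\le m\le k\le n-1$, let $c=c[k,m]=s_{k-m+1}\cdots s_{k-1}s_k$, and let $w\in W$ be arbitrary. Then in the ring $\Lambda$ one has $$\xi^{c}\,\xi^{w}=\sum_{0\le p\le m}\ \sum_{u\in S_{k,p}(w)}\xi^{c[k-p,\,m-p]}\bigl(v_{[u,w,k]}\bigr)\ \xi^{u},$$ where $S_{k,p}(w)$ is the set of elements special $k$-superior to $w$ of degree $p$, and $v_{[u,w,k]}\in W$ is the element associated with $u\in S_{k,p}(w)$ (both defined in the context).
   Context: Setting. $G=SL_n(\mathbb C)$, $\mathfrak h$ is the diagonal Cartan subalgebra, $L_1,\dots,L_n\in\mathfrak h^*$ are the coordinate functions ($L_i(\mathrm{diag}(t_1,\dots,t_n))=t_i$), so $L_1+\dots+L_n=0$. The Weyl group is $W=S_n$ acting on $\mathfrak h^*$ by $wL_i=L_{w(i)}$; products in $W$ are compositions of permutations, $(ww')(i)=w(w'(i))$. Simple roots: $\alpha_i=L_i-L_{i+1}$ ($1\le i\le n-1$); $\Delta_+=\{L_i-L_j: i<j\}$, $\Delta_-=-\Delta_+$. $s_i=(i\ i{+}1)$; $t_{ij}$ (with $i<j$) is the transposition $(i\ j)$; $\ell(w)$ is the Coxeter length; $\le$ is the Bruhat order. The ring $\Lambda$. Let $S=S(\mathfrak h^* )$ be the symmetric algebra, $Q$ its fraction field, and $\Omega$ the $S$-algebra of all functions $W\to Q$ with pointwise operations. For $f\in\Omega$ put $(\mathcal A_i f)(w)=\dfrac{f(ws_i)-f(w)}{w\alpha_i}$,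 and $\mathcal A_w=\mathcal A_{i_1}\circ\cdots\circ\mathcal A_{i_l}$ for a reduced decomposition $w=s_{i_1}\cdots s_{i_l}$ (independent of the choice). $\Lambda=\{f\in\Omega: f(w)\in S\text{ and }(\mathcal A_wf)(e)\in S\text{ for all }w\in W\}$. It is known that $\Lambda$ is a ring which is a free $S$-module with basis $\{\xi^w\}_{w\in W}$ (it is isomorphic to the $T$-equivariant cohomology of $G/B$, with $T$ the diagonal torus and $B$ the upper triangular subgroup), where the functions $\xi^w$ are characterized by: (1) $\xi^w(v)=0$ unless $w\le v$; (2) $\xi^w(w)=\prod_{\beta\in\Delta_+\cap w\Delta_-}\beta$; (3) $\mathcal A_i\xi^w=\xi^{ws_i}$ if $ws_i<w$, and $\mathcal A_i\xi^w=0$ otherwise. Elements $c[k,m]$. For $1\le m\le k\le n-1$, $c[k,m]=s_{k-m+1}\cdots s_{k-1}s_k$; also $c[k,0]=e$ for all $k\ge 0$. The sets $S_{k,p}(w)$. Let $\zeta=t_{i_1q}t_{i_2q}\cdots t_{i_pq}=(q\ i_p\ \dots\ i_2\ i_1)$ (i.e. $q\mapsto i_p\mapsto i_{p-1}\mapsto\cdots\mapsto i_1\mapsto q$), a $(p+1)$-cycle in $W$. Say $w\zeta$ is special $k$-superior to $w$ of degree $p$ if (i) $i_1,\dots,i_p\le k<q$; (ii) $w(q)>w(i_1)>\dots>w(i_p)$; (iii) $\ell(w\zeta)=\ell(w)+p$. More generally, if $\zeta_1,\dots,\zeta_r$ are pairwise disjoint cycles such that each $w\zeta_a$ is special $k$-superior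 to $w$ of degree $p_a$ and $\sum_a p_a=p$, then $w\zeta_1\cdots\zeta_r$ is called special $k$-superior to $w$ of degree $p$. $S_{k,p}(w)$ is the set of all such elements; $S_{k,0}(w)=\{w\}$. The element $v_{[u,w,k]}$. Let $u\in S_{k,p}(w)$. Put $\mathcal I=\{i\le k: w^{-1}u(i)\ne i\}$; it has exactly $p$ elements. Let $r_1>r_2>\dots>r_{k-p}$ be the elements of $\{1,\dots,k\}\setminus\mathcal I$ in decreasing order and $\lambda_j=\#\{i\in\mathcal I: i<r_j\}$, so $p\ge\lambda_1\ge\dots\ge\lambda_{k-p}\ge0$. For $1\le j\le k-p$ put $\pi_j=s_{\lambda_{k-p-j+1}+j-1}\cdots s_{j+1}s_j$ (indices decreasing by one from left to right) if $\lambda_{k-p-j+1}\ne0$, and $\pi_j=e$ if $\lambda_{k-p-j+1}=0$. Then $v_{[u,w,k]}=w\pi_1\pi_2\cdots\pi_{k-p}$.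
   Formalization: For products of several disjoint cycles, S_{k,p}(w) here also requires ℓ(u)=ℓ(w)+p for the whole product; without it the formula fails, e.g. n=4, k=m=2, w=2143, where (1 3),(2 4) give 4321 of length 6, not 4. *)

(* Defs.v *)
From HB Require Import structures.
From mathcomp Require Import all_boot all_order all_algebra all_fingroup.
From mathcomp Require Import boolp reals.
From mathcomp Require Import complex mpoly.

Set Implicit Arguments.
Unset Strict Implicit.
Unset Printing Implicit Defensive.

Import GRing.Theory.
Local Open Scope ring_scope.

(* Conventions.  G = SL_n(C) with n = r.+1, where r is the rank; W = 'S_r.+1.
   The field of complex numbers is R[i] for R : realType.
   The indices 1..r of the simple reflections and the integers k, m, p, j are
   natural numbers used with their usual 1-based meaning.  The points 1..n
   permuted by W are the ordinals 'I_r.+1, so that the point i is the ordinal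
   of value i.-1 : "i <= k" reads "i < k" and "k < q" reads "k <= q" on
   ordinals. *)

Section WeylGroup.
Variable r : nat.
Local Notation W := 'S_r.+1.

(* The product of MathComp is (s * t) x = t (s x). *)
Definition compW (x y : W) : W := (y * x)%g.
Local Notation "x *o y" := (compW x y) (at level 40, left associativity).

Lemma compWE (x y : W) i : (x *o y) i = x (y i).
Proof. exact: permM. Qed.

Definition prodW (s : seq W) : W := foldr compW 1%g s.

Lemma prodW_cat s t : prodW (s ++ t) = prodW s *o prodW t.
Proof.
elim: s => [|x s IHs]; first by rewrite /compW mulg1.
by rewrite /= IHs /compW mulgA.
Qed.

Definition pos (i : nat) : 'I_r.+1 := inord i.-1.

Definition sref (i : nat) : W := tperm (pos i) (pos i.+1).

Definition wordW (s : seq nat) : W := prodW (map sref s).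

Definition is_word (s : seq nat) : bool := all (fun i => 1 <= i <= r)%N s.

Lemma wordW_tperm (d : nat) (a b : 'I_r.+1) : (b = a + d :> nat)%N ->
  exists2 s, is_word s & wordW s = tperm a b.
Proof.
elim: d b => [|d IHd] b ba.
  exists [::] => //; rewrite [b](_ : _ = a) ?tperm1 //.
  by apply: val_inj; rewrite /= ba addn0.
have lt_ad : (a + d < r)%N by rewrite -addnS -ba -ltnS.
pose b' : 'I_r.+1 := Ordinal (leqW lt_ad).
have [s ws Es] := IHd b' erefl.
have Ep : pos (a + d).+1 = b' by apply: val_inj; rewrite /= inordK // ltnS ltnW.
have Eb : pos (a + d).+2 = b.
  by apply: val_inj; rewrite /= inordK ?ba ?addnS.
case: d {IHd} => [|d] in ba lt_ad b' s ws Es Ep Eb *.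
  exists [:: (a + 0).+1]; first by rewrite /is_word /= lt_ad.
  rewrite /wordW /= /compW mul1g /sref Ep Eb; congr tperm.
  by apply: val_inj; rewrite /= addn0.
exists ((a + d.+1).+1 :: s ++ [:: (a + d.+1).+1]).
  by rewrite /is_word /= all_cat -/(is_word s) ws /= lt_ad.
rewrite /wordW /= map_cat prodW_cat -/(wordW s) Es /= /sref Ep Eb /compW mul1g.
rewrite -{1}(tpermV b' b) -mulgA -conjgE tpermJ tpermL tpermD //.
  by rewrite -val_eqE /= -{2}[val a]addn0 eqn_add2l.
by rewrite -val_eqE /= ba -{2}[val a]addn0 eqn_add2l.
Qed.

Lemma wordW_surj (w : W) : exists2 s, is_word s & wordW s = w.
Proof.
have [ts -> _] := prod_tpermP w; elim: ts => [|[a b] ts [s ws Es]].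
  by exists [::]; rewrite // big_nil.
have [t wt Et] : exists2 s, is_word s & wordW s = tperm a b.
  have [/subnKC ab|/ltnW/subnKC ba] := leqP a b.
    exact: (wordW_tperm (esym ab)).
  by rewrite tpermC; apply: (wordW_tperm (esym ba)).
exists (s ++ t); first by rewrite /is_word all_cat -!/(is_word _) ws wt.
by rewrite big_cons /wordW map_cat prodW_cat -!/(wordW _) Es Et.
Qed.

Definition has_word_of_size (w : W) (l : nat) : bool :=
  [exists t : l.-tuple 'I_r, wordW [seq (val i).+1 | i <- t] == w].

Lemma has_word_of_sizeP (w : W) l :
  reflect (exists s, [/\ is_word s, size s = l & wordW s = w])
          (has_word_of_size w l).
Proof.
apply: (iffP existsP) => [[t /eqP wt]|[s [ws <- Ew]]].
  exists [seq (val i).+1 | i <- t]; split; rewrite ?size_map ?size_tuple //.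
  by apply/allP => _ /mapP[i _ ->] /=.
have Es : [seq (val i).+1 | i <- pmap insub (map predn s) : seq 'I_r] = s.
  elim: s ws {Ew} => //= i s IHs /andP[/andP[i1 ir] /IHs Es].
  by rewrite insubT ?prednK //= => lt_ir; rewrite prednK // Es.
have sz : size (pmap insub (map predn s) : seq 'I_r) == size s.
  by rewrite -{2}Es size_map.
by exists (Tuple sz); rewrite /= Es Ew.
Qed.

Lemma has_word_ex (w : W) : exists l, has_word_of_size w l.
Proof.
have [s ws Es] := wordW_surj w.
by exists (size s); apply/has_word_of_sizeP; exists s.
Qed.

Definition coxlen (w : W) : nat := ex_minn (has_word_ex w).

Definition reduced (w : W) (s : seq nat) : bool :=
  [&& is_word s, wordW s == w & size s == coxlen w].

Lemma reduced_ex (w : W) : exists s, reduced w s.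
Proof.
have : has_word_of_size w (coxlen w) by rewrite /coxlen; case: ex_minnP.
by case/has_word_of_sizeP => s [ws Es Ew]; exists s; rewrite /reduced ws Ew Es !eqxx.
Qed.

Definition reduced_word (w : W) : seq nat := xchoose (reduced_ex w).

Definition bruhat_step : rel W := fun x y =>
  [exists i : 'I_r.+1, exists j : 'I_r.+1,
    [&& (i < j)%N, y == x *o tperm i j & (coxlen x < coxlen y)%N]].
Definition bruhat_le : rel W := connect bruhat_step.
Definition bruhat_lt : rel W := fun x y => (x != y) && bruhat_le x y.

Definition c_elt (k m : nat) : W := wordW (iota (k - m).+1 m).

(* The pair z = ([:: i_1; ...; i_p], q) encodes the cycle
   zeta = t_{i_1 q} ... t_{i_p q}, of degree p. *)
Definition cycW (z : seq 'I_r.+1 * 'I_r.+1) : W :=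
  prodW [seq tperm i z.2 | i <- z.1].

Definition cyc_deg (z : seq 'I_r.+1 * 'I_r.+1) : nat := size z.1.

Definition cyc_supp (z : seq 'I_r.+1 * 'I_r.+1) : seq 'I_r.+1 := z.2 :: z.1.

Definition special_cycle (k : nat) (w : W) : pred (seq 'I_r.+1 * 'I_r.+1) :=
  fun z =>
  [&& (0 < cyc_deg z)%N,
      all (fun i : 'I_r.+1 => i < k)%N z.1 && (k <= z.2)%N,
      path (fun a b => w b < w a)%N z.2 z.1
    & coxlen (w *o cycW z) == (coxlen w + cyc_deg z)%N].

(* The last clause is condition (iii), l(u) = l(w) + p, for the whole product.
   It does not follow from the conditions on the individual cycles: for n = 4,
   k = 2 and w = 2143, the cycles (1 3) and (2 4) are disjoint and special of
   degree 1, but w (1 3)(2 4) = 4321 has length 6 = l(w) + 4. *)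
Definition superior (k p : nat) (w u : W) : Prop :=
  exists zs : seq (seq 'I_r.+1 * 'I_r.+1),
  [/\ all (special_cycle k w) zs,
      pairwise (fun z z' => [disjoint cyc_supp z & cyc_supp z']) zs,
      sumn (map cyc_deg zs) = p,
      u = w *o prodW (map cycW zs)
    & coxlen u = (coxlen w + p)%N].

Definition superior_set (k p : nat) (w : W) : {set W} :=
  [set u | `[< superior k p w u >]].

Definition moved (u w : W) (k : nat) : {set 'I_r.+1} :=
  [set i : 'I_r.+1 | (i < k)%N && ((w^-1%g *o u) i != i)].

Definition unmoved_seq (u w : W) (k : nat) : seq 'I_r.+1 :=
  rev [seq i : 'I_r.+1 <- enum 'I_r.+1 | (i < k)%N && (i \notin moved u w k)].

Definition lam (u w : W) (k j : nat) : nat :=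
  #|[set i : 'I_r.+1 in moved u w k | (i < nth ord0 (unmoved_seq u w k) j.-1)%N]|.

(* Here #|moved u w k| is p when u is in superior_set k p w. *)
Definition pi_elt (u w : W) (k j : nat) : W :=
  wordW (rev (iota j (lam u w k (k - #|moved u w k| - j + 1)))).

Definition v_elt (u w : W) (k : nat) : W :=
  w *o prodW [seq pi_elt u w k j | j <- iota 1 (k - #|moved u w k|)].

End WeylGroup.

Notation "x *o y" := (compW x y) (at level 40, left associativity).

Section Lambda.
Variables (R : realType) (r : nat).
Local Notation W := 'S_r.+1.

(* S(h^* ), the variables being the basis L_1, ..., L_{n-1} of h^*. *)
Definition Sring := {mpoly R[i][r]}.
Definition Qfrac := {fraction Sring}.
Definition Omega := {ffun W -> Qfrac^o}.

Definition Lcoord (i : 'I_r.+1) : Sring :=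
  if unlift ord_max i is Some j then 'X_j else - \sum_(j < r) 'X_j.

Lemma sum_Lcoord : \sum_i Lcoord i = 0.
Proof.
rewrite big_ord_recr /= {2}/Lcoord unlift_none; apply/eqP; rewrite subr_eq0; apply/eqP.
apply: eq_bigr => j _; rewrite /Lcoord.
have -> : widen_ord (leqnSn r) j = lift ord_max j.
  by apply: val_inj; rewrite /= /bump leqNgt ltn_ord.
by rewrite liftK.
Qed.

(* The algebra endomorphism of S that extends the action of w on h^*. *)
Definition actS (w : W) (f : Sring) : Sring :=
  f \mPo [tuple Lcoord (w (lift ord_max j)) | j < r].

Lemma actS_Lcoord (w : W) i : actS w (Lcoord i) = Lcoord (w i).
Proof.
have actSX j : actS w 'X_j = Lcoord (w (lift ord_max j)).
  by rewrite /actS comp_mpolyXU -tnth_nth tnth_mktuple.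
rewrite /Lcoord; case: unliftP => [j ->|->]; first exact: actSX.
rewrite /actS comp_mpolyN (big_morph _ (comp_mpolyD _) (comp_mpoly0 _)).
rewrite (eq_bigr (fun j => Lcoord (w (lift ord_max j)))); last by move=> j _; exact: actSX.
have := sum_Lcoord; rewrite (reindex_inj (@perm_inj _ w)) big_ord_recr /=.
move/eqP; rewrite addr_eq0 => /eqP Es.
rewrite -[RHS]opprK -Es; congr (- _); apply: eq_bigr => j _; congr (Lcoord (w _)).
by apply: val_inj; rewrite /= /bump leqNgt ltn_ord.
Qed.

Definition alpha (i : nat) : Sring := Lcoord (pos r i) - Lcoord (pos r i.+1).

Definition Delta_pos : seq Sring :=
  [seq Lcoord ij.1 - Lcoord ij.2
     | ij : 'I_r.+1 * 'I_r.+1 <- enum {: 'I_r.+1 * 'I_r.+1} & (ij.1 < ij.2)%N].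
Definition Delta_neg : seq Sring := [seq - b | b <- Delta_pos].

Local Notation "x %:F" := (@FracField.tofrac Sring x).

Definition inS (q : Qfrac) : Prop := exists s : Sring, q = s%:F.

Definition calA_i (i : nat) (f : Omega) : Omega :=
  [ffun w => (f (w *o sref r i) - f w) / (actS w (alpha i))%:F].

Definition calA (w : W) (f : Omega) : Omega :=
  foldr calA_i f (reduced_word w).

Definition inLambda (f : Omega) : Prop :=
  (forall w, inS (f w)) /\ (forall w, inS (calA w f 1%g)).

(* These conditions determine xi: the first two fix xi w0 for the longest
   element w0, and the third one gives the other xi w by descending induction
   on the length of w. *)
Definition schubert_basis (xi : W -> Omega) : Prop :=
  [/\ forall w, inLambda (xi w),
      forall w v, ~~ bruhat_le w v -> xi w v = 0,
      forall w, xi w w =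
        (\prod_(b <- Delta_pos | b \in [seq actS w a | a <- Delta_neg]) b)%:F
    & forall w i, (1 <= i <= r)%N ->
        calA_i i (xi w) =
        if bruhat_lt (w *o sref r i) w then xi (w *o sref r i) else 0].

End Lambda.

(* Main.v *)
Require Import Defs.
From HB Require Import structures.
From mathcomp Require Import all_boot all_order all_algebra all_fingroup.
From mathcomp Require Import boolp reals.
From mathcomp Require Import complex mpoly zify ring.

Set Implicit Arguments.
Unset Strict Implicit.
Unset Printing Implicit Defensive.

Import GRing.Theory.
Local Open Scope ring_scope.

(** Evaluate everything at a point x of W and let L_x(i) stand for L_{x(i)}.
    The numbers xi^{c[k,m]}(x) are the coefficients of prod_{i <= k} (X - L_{x(i)})
    in the Newton basis N_d = prod_{i <= d} (X - L_i), namely that of N_{k-m}.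
    Since v_{[u,w,k]} maps 1, ..., k-p to the w(i) with i <= k and u(i) = w(i),
    the theorem is the coefficient of N_{k-m} in the single polynomial identity
      prod_{i <= k} (X - L_{x(i)}) xi^w(x)
        = sum_u prod_{i <= k, u(i) = w(i)} (X - L_{w(i)}) xi^u(x),
    u running over all elements that are special k-superior to w.
    By the equivariant Monk formula, multiplication by X - L_{x(j)} acts on the
    family (xi^w(x))_w as a Dunkl element: X - L_{w(j)} plus a signed sum of the
    Bruhat operators w |-> w t_ij. These operators satisfy the quadratic relations
    of Fomin and Kirillov, and the identity follows by induction on k as in
    Postnikov's proof of the Pieri formula in the Fomin-Kirillov algebra. *)

(** * Coxeter length and inversions *)

Section Length.
Variable r : nat.
Implicit Types (w : 'S_r.+1) (a b : 'I_r.+1) (i : nat).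

(** The variable X treats all m at once: the generating polynomial gains exactly one linear factor
    when k grows by one. For fixed x this factor X - L_{x(j)} is a scalar, so it passes through
    every operator, and on the vector of all xi^w(x) it may be replaced by a Dunkl element, which no
    longer mentions x. The step from k to k + 1 thereby becomes an identity between operators: the
    new position j leaves the list J of possible q and joins the set I of possible i. As long as the
    list does not contain j, the Dunkl element yields the wanted terms minus corrections that begin
    with [bop i j]; putting j at the head of the list supplies these corrections with the opposite
    sign. What then survives applies the same t_ij at both ends and dies, as [ij]^2 does in the
    Fomin-Kirillov algebra. The operators are defined for arbitrary I and J because the identity is
    proved by induction on J with an inner induction on I. *)

Lemma tperm_adj_lt a b x y : b = a.+1 :> nat -> (x, y) != (a, b) ->
  (x, y) != (b, a) -> (tperm a b x < tperm a b y)%N = (x < y)%N.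
Proof.
rewrite !xpair_eqE -!val_eqE => ba.
by case: tpermP => [->|->|/eqP + /eqP]; case: tpermP => [->|->|/eqP + /eqP];
  rewrite -?val_eqE /=; lia.
Qed.

Definition inversions w : {set 'I_r.+1 * 'I_r.+1} :=
  [set p : 'I_r.+1 * 'I_r.+1 | (p.1 < p.2)%N && (w p.2 < w p.1)%N].

Lemma card_inversions_adj a b w : b = a.+1 :> nat -> (w a < w b)%N ->
  #|inversions (w *o tperm a b)| = #|inversions w|.+1.
Proof.
move=> ba lt_w; pose t := tperm a b; pose f (p : 'I_r.+1 * 'I_r.+1) := (t p.1, t p.2).
have inj_f : injective f by move=> [x y] [x' y'] [/perm_inj-> /perm_inj->].
have ab : a != b by rewrite -val_eqE /= ba; lia.
rewrite -(card_preimset (inversions w) inj_f).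
suff -> : inversions (w *o t) = (a, b) |: f @^-1: inversions w.
  by rewrite cardsU1 !inE /= /t tpermL tpermR (ltnNge b) (_ : (a <= b)%N) // ba; lia.
apply/setP => -[x y]; rewrite !inE /= !compWE.
have [[-> ->]|nab] := eqVneq (x, y) (a, b).
  by rewrite /t tpermL tpermR lt_w ba ltnSn.
have [[-> ->]|nba] := eqVneq (x, y) (b, a).
  by rewrite /t tpermL tpermR ba; lia.
by rewrite tperm_adj_lt.
Qed.

Lemma card_inversions_adj_desc a b w : b = a.+1 :> nat -> (w b < w a)%N ->
  #|inversions w| = #|inversions (w *o tperm a b)|.+1.
Proof.
move=> ba lt_w; rewrite -(card_inversions_adj ba) ?compWE ?tpermL ?tpermR //.
by rewrite /compW mulgA tperm2 mul1g.
Qed.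

Lemma pos_val i : (0 < i)%N -> (i <= r.+1)%N -> pos r i = i.-1 :> nat.
Proof. by move=> i0 ir; rewrite /pos inordK //; lia. Qed.

Lemma pos_succ i : (0 < i <= r)%N -> pos r i.+1 = (pos r i).+1 :> nat.
Proof. by case/andP=> i0 ir; rewrite !pos_val; lia. Qed.

Lemma wordW_rcons s i : wordW r (rcons s i) = wordW r s *o sref r i.
Proof. by rewrite /wordW map_rcons -cats1 prodW_cat /= /compW mul1g. Qed.

Lemma card_inversions_word s : is_word r s -> (#|inversions (wordW r s)| <= size s)%N.
Proof.
elim/last_ind: s => [|s i IHs].
  rewrite /wordW /= => _; rewrite eq_card0 // => -[x y]; rewrite !inE !perm1 /=.
  by case: ltngtP.
rewrite /is_word all_rcons => /andP[ir ws]; rewrite wordW_rcons size_rcons.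
have := pos_succ ir; set a := pos r i; set b := pos r i.+1 => ba.
have [lt_w|lt_w|/val_inj/perm_inj E] := ltngtP (wordW r s a) (wordW r s b).
- by rewrite card_inversions_adj // ltnS IHs.
- by apply: leqW; apply: ltnW; rewrite -card_inversions_adj_desc ?IHs.
- by move: ba; rewrite -E; lia.
Qed.

Lemma perm_ascending w :
  (forall a b, b = a.+1 :> nat -> (w a < w b)%N) -> w = 1%g.
Proof.
move=> up; have ge_w k a : a = k :> nat -> (a <= w a)%N.
  elim: k a => [|k IHk] a ak; first by rewrite ak.
  have lt_k : (k < r.+1)%N by have := ltn_ord a; lia.
  have := up (Ordinal lt_k) a ak; have := IHk (Ordinal lt_k) erefl; rewrite /=; lia.
(* The sums of a and of w(a) over all positions agree, so the inequalities a <= w(a) are all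
   equalities. *)
have := @leqif_sum _ predT (fun a => a == w a :> nat) (fun a => a : nat) (fun a => w a : nat)
  (fun a _ => conj (ge_w a a erefl) erefl).
rewrite -(reindex_inj (@perm_inj _ w) (P := predT) (F := fun a => a : nat)) => -[_].
rewrite eqxx => /esym/forallP fix_w; apply/permP => a; rewrite perm1.
by apply/val_inj/esym/eqP; have := fix_w a.
Qed.

Lemma coxlen_min w s : is_word r s -> wordW r s = w -> (coxlen w <= size s)%N.
Proof.
move=> ws Es; rewrite /coxlen; case: ex_minnP => l _; apply.
by apply/has_word_of_sizeP; exists s.
Qed.

Lemma reduced_coxlen w : exists s, [/\ is_word r s, size s = coxlen w & wordW r s = w].
Proof. by have [s /and3P[ws /eqP Es /eqP sz]] := reduced_ex w; exists s. Qed.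

Lemma coxlenE w : coxlen w = #|inversions w|.
Proof.
apply/eqP; rewrite eqn_leq; apply/andP; split; last first.
  by have [s [ws <- {1}<-]] := reduced_coxlen w; apply: card_inversions_word.
suff [s [ws <- Es]] : exists s, [/\ is_word r s, size s = #|inversions w| & wordW r s = w].
  exact: coxlen_min.
(* Sorting by adjacent transpositions: each removed descent lowers the number of inversions by one,
   which yields a word of exactly that length. *)
elim: {w}#|inversions w| {-2}w (erefl #|inversions w|) => [|l IHl] w lw.
  exists [::]; split=> //; apply/esym/perm_ascending => a b ba.
  have [//|lt_w|/val_inj/perm_inj E] := ltngtP (w a) (w b).
    by move: lw; rewrite (card_inversions_adj_desc ba lt_w).
  by move: ba; rewrite E; lia.
have [/existsP[a /existsP[b /andP[/eqP ba lt_w]]]|/existsPn no] :=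
  boolP [exists a : 'I_r.+1, exists b : 'I_r.+1, (b == a.+1 :> nat) && (w b < w a)%N]; last first.
  suff w1 : w = 1%g.
    move: lw; rewrite w1 eq_card0 // => -[x y]; rewrite !inE !perm1 /=; by case: ltngtP.
  apply: perm_ascending => a b ba; have /existsPn/(_ b) := no a.
  rewrite /= ba eqxx /= -leqNgt leq_eqVlt => /orP[/eqP/val_inj/perm_inj E|//].
  by move: ba; rewrite E; lia.
have Elw : #|inversions (w *o tperm a b)| = l.
  by move: lw; rewrite (card_inversions_adj_desc ba lt_w) => -[].
have [s [ws sz Es]] := IHl _ Elw.
have lt_a : (a < r)%N by have := ltn_ord b; lia.
have Ea : pos r a.+1 = a by apply: val_inj; rewrite /= pos_val //=; lia.
have Eb : pos r a.+2 = b by apply: val_inj; rewrite /= pos_val //=; lia.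
exists (rcons s a.+1); split; rewrite ?size_rcons ?sz ?Elw ?lw //.
  by rewrite /is_word all_rcons -/(is_word r s) ws lt_a.
by rewrite wordW_rcons Es /sref Ea Eb /compW mulgA tperm2 mul1g.
Qed.

Lemma coxlen_adj a b w : b = a.+1 :> nat -> (w a < w b)%N ->
  coxlen (w *o tperm a b) = (coxlen w).+1.
Proof. by move=> ba lt_w; rewrite !coxlenE card_inversions_adj. Qed.

Lemma coxlen_adj_desc a b w : b = a.+1 :> nat -> (w b < w a)%N ->
  coxlen w = (coxlen (w *o tperm a b)).+1.
Proof. by move=> ba lt_w; rewrite !coxlenE (card_inversions_adj_desc ba). Qed.

Lemma coxlen1 : coxlen (1%g : 'S_r.+1) = 0%N.
Proof.
by apply/eqP; rewrite -leqn0; apply: (coxlen_min (s := [::])).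
Qed.

Lemma coxlen_eq0 w : coxlen w = 0%N -> w = 1%g.
Proof. by have [s [_ <- <-]] := reduced_coxlen w => /size0nil ->. Qed.

(** For c = b - 1 the factorization t_ab = t_cb t_ac t_cb brings the distance down by one. The two
    outer factors are adjacent, so each changes the length by one, and they cannot both lower it. *)
Lemma coxlen_tperm a b w : (a < b)%N -> (w a < w b)%N ->
  (coxlen w < coxlen (w *o tperm a b))%N.
Proof.
move: {2}(b - a)%N (leqnn (b - a)%N) => d; elim: d a b w => [|d IHd] a b w; first by lia.
move=> le_d ab lt_w; have [ba|nba] := eqVneq (b : nat) a.+1; first by rewrite coxlen_adj.
have lt_c : (b.-1 < r.+1)%N by have := ltn_ord b; lia.
pose c := Ordinal lt_c; have bc : b = c.+1 :> nat by rewrite /=; lia.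
have [nab nac nbc] : [/\ a != b, a != c & b != c] by rewrite -!val_eqE /=; split; lia.
have Et : w *o tperm a b = w *o tperm c b *o tperm a c *o tperm c b.
  apply/permP => x; rewrite !compWE; congr (w _).
  rewrite -!permM; congr (fun_of_perm _ x).
  rewrite mulgA -{1}(tpermV c b) -mulgA -conjgE tpermJ tpermL tpermD //; by rewrite eq_sym.
have lt_w' : (coxlen (w *o tperm c b) < coxlen (w *o tperm c b *o tperm a c))%N.
  by apply: IHd; rewrite ?compWE ?tpermL ?(tpermD (z := a)) /= 1?eq_sym //; lia.
have [lt_cb|lt_cb|/val_inj/perm_inj E] := ltngtP (w c) (w b).
- have Ec := coxlen_adj bc lt_cb.
  suff : (coxlen (w *o tperm c b *o tperm a c) <= (coxlen (w *o tperm a b)).+1)%N by lia.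
  rewrite Et; have [lt_x|lt_x|/val_inj/perm_inj E] :=
    ltngtP ((w *o tperm c b *o tperm a c) c) ((w *o tperm c b *o tperm a c) b).
  + by rewrite (coxlen_adj bc lt_x); lia.
  + by rewrite (coxlen_adj_desc bc lt_x).
  + by rewrite E eqxx in nbc.
- have lt_x : ((w *o tperm c b *o tperm a c) c < (w *o tperm c b *o tperm a c) b)%N.
    have [Ea Eb] : tperm c b a = a /\ tperm a c b = b by rewrite !tpermD // eq_sym.
    by rewrite !compWE tpermR Ea Eb tpermR (ltn_trans lt_w lt_cb).
  by rewrite (coxlen_adj_desc bc lt_cb) Et (coxlen_adj bc lt_x).
- by rewrite E eqxx in nbc.
Qed.

Lemma coxlen_tperm_lt a b w : (a < b)%N ->
  (coxlen w < coxlen (w *o tperm a b))%N = (w a < w b)%N.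
Proof.
move=> ab; apply/idP/idP; last exact: coxlen_tperm.
have [//|lt_w|/val_inj/perm_inj E] := ltngtP (w a) (w b); last by rewrite E ltnn in ab.
have := @coxlen_tperm a b (w *o tperm a b) ab; rewrite !compWE tpermL tpermR lt_w.
by rewrite {2}/compW /compW mulgA tperm2 mul1g => /(_ isT); lia.
Qed.

End Length.

(** * Bruhat operators *)

Section Operators.
Variables (r : nat) (K : comNzRingType) (y : 'I_r.+1 -> K).
Implicit Types (w : 'S_r.+1) (a b i j q : 'I_r.+1) (I : {set 'I_r.+1}).
Local Notation V := {ffun 'S_r.+1 -> K}.
Implicit Types u v : V.

Definition covers w i j := (i < j)%N && (coxlen (w *o tperm i j) == (coxlen w).+1).

Lemma covers_lt w i j : covers w i j -> (w i < w j)%N.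
Proof. by case/andP=> ij /eqP E; rewrite -coxlen_tperm_lt // E. Qed.

(** Each ascent raises the length by at least one, so a total rise of two forces two covers. The
    length condition then depends only on the product of the two transpositions, which is what
    relations between operators compare. *)
Lemma covers2 w i j a b : (i < j)%N -> (a < b)%N ->
  covers w i j && covers (w *o tperm i j) a b =
  [&& (w i < w j)%N, ((w *o tperm i j) a < (w *o tperm i j) b)%N
    & coxlen (w *o tperm i j *o tperm a b) == (coxlen w).+2].
Proof.
move=> ij ab; rewrite /covers -!coxlen_tperm_lt // ij ab /=.
set l1 := coxlen (_ *o _); set l2 := coxlen (_ *o _); lia.
Qed.

(** The operators act on functions of w, so in a composite the outermost one is the first step away
    from w: [bop i j (bop a b v)] follows w, w t_ij, w t_ij t_ab. *)
Definition bop i j v : V := [ffun w => if covers w i j then v (w *o tperm i j) else 0].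

Fact bop_is_zmod_morphism i j : zmod_morphism (bop i j).
Proof. by move=> u v; apply/ffunP=> w; rewrite !ffunE; case: ifP; rewrite ?subr0. Qed.
HB.instance Definition _ i j :=
  GRing.isZmodMorphism.Build V V (bop i j) (bop_is_zmod_morphism i j).

Lemma bop2E w i j a b v : (i < j)%N -> (a < b)%N ->
  bop i j (bop a b v) w =
  if [&& (w i < w j)%N, ((w *o tperm i j) a < (w *o tperm i j) b)%N
    & coxlen (w *o tperm i j *o tperm a b) == (coxlen w).+2]
  then v (w *o tperm i j *o tperm a b) else 0.
Proof.
by move=> ij ab; rewrite -covers2 // !ffunE; case: (covers w i j).
Qed.

Lemma bop0 i j v : ~~ (i < j)%N -> bop i j v = 0.
Proof. by move=> ij; apply/ffunP=> w; rewrite !ffunE /covers (negPf ij). Qed.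

Lemma bop_comm i j a b v : i != a -> i != b -> j != a -> j != b ->
  bop i j (bop a b v) = bop a b (bop i j v).
Proof.
move=> ia ib ja jb.
have [ij|ij] := boolP (i < j)%N; last by rewrite !(bop0 _ ij) raddf0.
have [ab|ab] := boolP (a < b)%N; last by rewrite !(bop0 _ ab) raddf0.
apply/ffunP=> w; rewrite !bop2E //.
have -> : w *o tperm i j *o tperm a b = w *o tperm a b *o tperm i j.
  rewrite /compW !mulgA; congr (_ * w)%g.
  by rewrite conjgC tpermJ !tpermD.
rewrite !compWE; have [-> ->] : tperm i j a = a /\ tperm i j b = b by rewrite !tpermD.
have [-> ->] : tperm a b i = i /\ tperm a b j = j by rewrite !tpermD // eq_sym.
by rewrite andbCA.
Qed.

(* One instance of the three-term relation of the Fomin-Kirillov algebra. The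
   three paths multiply w by the same 3-cycle; a path on the right exists iff the
   one on the left does, and then it is unique. *)
Lemma bop_three_term a j q v : (a < j)%N -> (j < q)%N ->
  bop a j (bop j q v) = bop a q (bop a j v) + bop j q (bop a q v).
Proof.
move=> aj jq; have aq := ltn_trans aj jq.
have [naj naq njq] : [/\ a != j, a != q & j != q] by rewrite -!val_eqE /=; split; lia.
have E1 w0 : w0 *o tperm a q *o tperm a j = w0 *o tperm a j *o tperm j q.
  rewrite /compW !mulgA; congr (_ * w0)%g.
  by rewrite [RHS]conjgC tpermJ tpermR tpermD.
have E2 w0 : w0 *o tperm j q *o tperm a q = w0 *o tperm a j *o tperm j q.
  rewrite /compW !mulgA; congr (_ * w0)%g.
  by rewrite conjgC tpermJ tpermR tpermD // eq_sym.
apply/ffunP=> w; rewrite [RHS]ffunE !bop2E // E1 E2 !compWE !(tpermL, tpermR).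
have [-> -> ->] : [/\ tperm a j q = q, tperm a q j = j & tperm j q a = a].
  by rewrite !tpermD // eq_sym.
(* All three terms now share the length condition and the value of v. What remains is that the case
   where w(a) lies below both w(j) and w(q) splits into w(q) < w(j) and w(j) < w(q). *)
case: (_ == _.+2); rewrite ?andbF ?addr0 // !andbT.
have nw : (w j : nat) <> w q by move/val_inj/perm_inj/eqP; rewrite (negPf njq).
by case: (ltngtP (w a) (w j)) => h1; case: (ltngtP (w a) (w q)) => h2;
  case: (ltngtP (w j) (w q)) => h3; rewrite ?addr0 ?add0r //; exfalso; lia.
Qed.

Definition weight I v : V := [ffun w : 'S_r.+1 => (\prod_(i in I) y (w i)) * v w].

Fact weight_is_zmod_morphism I : zmod_morphism (weight I).
Proof. by move=> u v; apply/ffunP=> w; rewrite !ffunE mulrBr. Qed.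
HB.instance Definition _ I :=
  GRing.isZmodMorphism.Build V V (weight I) (weight_is_zmod_morphism I).

(** The recursion is on a set, so n is fuel; n = #|I| always suffices, since each step removes an
    element of I. *)
Fixpoint chains (q : 'I_r.+1) (f : {set 'I_r.+1} -> V) n I : V :=
  f I + (if n is m.+1 then \sum_(i in I) bop i q (chains q f m (I :\ i)) else 0).

(* The sum, over all ways of attaching to the elements q of J disjoint ordered
   lists i_1, ..., i_p of elements of I, of the products of the operators
   bop i_1 q \o ... \o bop i_p q, weighted by the unused elements of I. *)
Fixpoint pieri (J : seq 'I_r.+1) I v : V :=
  if J is q :: J' then chains q (fun I' => pieri J' I' v) #|I| I else weight I v.

(** Either the list attached to q is empty, or i is its first entry and the rest of the list avoids
    i. *)
Lemma pieri_cons q J I v :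
  pieri (q :: J) I v = pieri J I v + \sum_(i in I) bop i q (pieri (q :: J) (I :\ i) v).
Proof.
rewrite /=; case: {2}#|I| (erefl #|I|) => [/eqP|n In] /=.
  by rewrite cards_eq0 => /eqP->; rewrite cards0 big_set0.
rewrite In /=; congr (_ + _); apply: eq_bigr => i Ii.
by move: In; rewrite (cardsD1 i) Ii add1n => -[->].
Qed.

Lemma pieri_nil I v : pieri [::] I v = weight I v.
Proof. by []. Qed.

Arguments pieri : simpl never.

Lemma set_ind (P : {set 'I_r.+1} -> Prop) :
  (forall I, (forall i, i \in I -> P (I :\ i)) -> P I) -> forall I, P I.
Proof.
move=> IH I; move: {2}#|I| (leqnn #|I|) => n; elim: n I => [|n IHn] I le_n.
  by apply: IH => i Ii; move: le_n; rewrite (cardsD1 i) Ii.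
by apply: IH => i Ii; apply: IHn; move: le_n; rewrite (cardsD1 i) Ii.
Qed.

Fact pieri_is_zmod_morphism J I : zmod_morphism (pieri J I).
Proof.
move=> u v; elim: J I => [|q J IHJ] I; first exact: raddfB.
elim/set_ind: I => I IHI; rewrite !pieri_cons IHJ opprD addrACA -sumrB.
by congr (_ + _); apply: eq_bigr => i Ii; rewrite IHI // raddfB.
Qed.
HB.instance Definition _ J I :=
  GRing.isZmodMorphism.Build V V (pieri J I) (pieri_is_zmod_morphism J I).

Lemma weight_bop_comm a b I v : a \notin I -> b \notin I ->
  weight I (bop a b v) = bop a b (weight I v).
Proof.
move=> aI bI; apply/ffunP=> w; rewrite !ffunE; case: ifP => _; rewrite ?mulr0 //.
congr (_ * _); apply: eq_bigr => i Ii; rewrite compWE tpermD //.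
  by apply: contraNneq aI => ->.
by apply: contraNneq bI => ->.
Qed.

Lemma pieri_bop_comm a b J I v :
  a \notin I -> b \notin I -> a \notin J -> b \notin J ->
  pieri J I (bop a b v) = bop a b (pieri J I v).
Proof.
move=> + + aJ bJ; elim: J aJ bJ I => [|q J IHJ] aJ bJ I; first exact: weight_bop_comm.
move: aJ bJ; rewrite !inE !negb_or => /andP[aq aJ] /andP[bq bJ].
have [qa qb] : q != a /\ q != b by rewrite ![q == _]eq_sym.
elim/set_ind: I => I IHI aI bI; rewrite !pieri_cons IHJ // raddfD raddf_sum.
congr (_ + _); apply: eq_bigr => i Ii.
rewrite IHI ?inE ?(negPf aI) ?(negPf bI) ?andbF // bop_comm //.
- by apply: contraNneq aI => <-.
- by apply: contraNneq bI => <-.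
Qed.

(** The value of w t_ij at j is w(i), so the factor of position i before the step is the factor of
    position j after it. *)
Lemma weight_bop_swap i j I v : i \in I -> j \notin I ->
  weight I (bop i j v) = bop i j (weight (j |: I :\ i) v).
Proof.
move=> iI jI; apply/ffunP=> w; rewrite !ffunE; case: ifP => _; rewrite ?mulr0 //.
congr (_ * _); rewrite big_setU1 ?inE ?(negPf jI) ?andbF //= (big_setD1 i) //=.
rewrite compWE tpermR; congr (_ * _); apply: eq_bigr => a /setD1P[ai aI].
by rewrite compWE tpermD // 1?eq_sym //; apply: contraNneq jI => <-.
Qed.

(** The Dunkl element at position j, a sum of Jucys-Murphy type: positions after j enter with a plus
    sign, positions before j with a minus sign. *)
Definition jucys (J : seq 'I_r.+1) I j v : V :=
  weight [set j] v + \sum_(q <- J) bop j q v - \sum_(i in I) bop i j v.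

(** Induction on J, then on I, using commutation for disjoint transpositions and the three-term
    relation. The subtracted sum is the defect that disappears once j heads the list, in
    [pieri_cons_jucys]. *)
Lemma pieri_jucys J I j v : uniq J -> {in I, forall i, i < j}%N ->
    {in J, forall q, j < q}%N ->
  pieri J I (jucys J I j v) =
    pieri J (j |: I) v - \sum_(i in I) bop i j (pieri J (j |: I :\ i) v).
Proof.
elim: J I => [|q J IHJ] I.
  move=> _ lt_I _; have jI : j \notin I by apply/negP => /lt_I; rewrite ltnn.
  rewrite !pieri_nil /jucys big_nil addr0 raddfB raddf_sum; congr (_ - _).
    apply/ffunP=> w; rewrite !ffunE big_set1 big_setU1 //= mulrA.
    by congr (_ * _); rewrite mulrC.
  by apply: eq_bigr => i iI; rewrite /= weight_bop_swap.
rewrite cons_uniq => /andP[qJ uJ] + ltJ.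
have jq : (j < q)%N by apply: ltJ; rewrite mem_head.
have {}ltJ : {in J, forall q, j < q}%N by move=> x xJ; apply: ltJ; rewrite inE xJ orbT.
have jJ : j \notin J by apply/negP => /ltJ; rewrite ltnn.
have njq : j != q by rewrite -val_eqE /=; lia.
elim/set_ind: I => I IHI lt_I.
have jI : j \notin I by apply/negP => /lt_I; rewrite ltnn.
have qI : q \notin I by apply/negP => /lt_I; lia.
have Ej : jucys (q :: J) I j v = jucys J I j v + bop j q v.
  by rewrite /jucys big_cons [bop j q v + _]addrC addrA [LHS]addrAC.
have Ei i : i \in I -> jucys (q :: J) I j v = jucys (q :: J) (I :\ i) j v - bop i j v.
  by move=> iI; rewrite /jucys (big_setD1 i iI) /= [bop i j v + _]addrC opprD addrA.
have EU i : i \in I -> (j |: I) :\ i = j |: I :\ i.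
  move=> iI; apply/setP=> x; rewrite !inE; case: eqVneq => //= ->.
  by rewrite (negPf (memPn jI _ iI)).
have Uj : (j |: I) :\ j = I by rewrite setU1K.
have Ui i : i \in I -> (j |: I :\ i) :\ j = I :\ i.
  by move=> iI; rewrite setU1K // !inE (negPf jI) andbF.
have jIi i : j \notin I :\ i by rewrite !inE (negPf jI) andbF.
pose Q := pieri (q :: J); pose P := pieri J.
(* Split off q. The part without q falls under the hypothesis for J. In a part beginning with
   [bop i q], shrinking I to [I :\ i] leaves an extra [bop i q (bop i j _)], which the three-term
   relation turns into the last difference. *)
have -> : pieri (q :: J) I (jucys (q :: J) I j v) =
    P (j |: I) v - \sum_(i in I) bop i j (P (j |: I :\ i) v) + bop j q (P I v)
    + (\sum_(i in I) bop i q (Q (j |: I :\ i) v)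
       - \sum_(i in I) \sum_(i' in I :\ i) bop i q (bop i' j (Q (j |: I :\ i :\ i') v))
       - (\sum_(i in I) bop i j (bop j q (Q (I :\ i) v))
          - bop j q (\sum_(i in I) bop i q (Q (I :\ i) v)))).
  rewrite pieri_cons {1}Ej raddfD /= IHJ // pieri_bop_comm //; congr (_ + _).
  rewrite (raddf_sum (bop j q)) -!sumrB; apply: eq_bigr => i iI.
  rewrite (Ei i) // raddfB /= IHI //; last by move=> x /setD1P[_ /lt_I].
  have ii : i \notin I :\ i by rewrite !inE eqxx.
  have iqJ : i \notin q :: J.
    rewrite inE negb_or; apply/andP; split; first by apply: contraNneq qI => <-.
    by apply/negP => /ltJ; have := lt_I i iI; lia.
  have jqJ : j \notin q :: J by rewrite inE negb_or njq.
  rewrite pieri_bop_comm //.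
  rewrite !raddfB raddf_sum /= bop_three_term ?lt_I //.
  by rewrite opprK opprD subrK.
have -> : pieri (q :: J) (j |: I) v = P (j |: I) v + (bop j q (P I v)
    + bop j q (\sum_(i in I) bop i q (Q (I :\ i) v)))
    + \sum_(i in I) bop i q (Q (j |: I :\ i) v).
  rewrite pieri_cons big_setU1 //= -addrA Uj -raddfD -pieri_cons.
  by congr (_ + (_ + _)); apply: eq_bigr => i iI; rewrite EU.
have -> : \sum_(i in I) bop i j (pieri (q :: J) (j |: I :\ i) v) =
    \sum_(i in I) bop i j (P (j |: I :\ i) v)
    + \sum_(i in I) bop i j (bop j q (Q (I :\ i) v))
    + \sum_(i in I) \sum_(i' in I :\ i) bop i q (bop i' j (Q (j |: I :\ i :\ i') v)).
  under eq_bigr => i iI do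
    rewrite pieri_cons big_setU1 ?jIi //= Ui // !raddfD raddf_sum /= addrA.
  rewrite !big_split /=; congr (_ + _).
  (* Interchanging the names i and i' and commuting the two disjoint transpositions matches this
     double sum with the one obtained on the left. *)
  rewrite (exchange_big_dep (mem I)) /=; last by move=> i i' _ /setD1P[].
  apply: eq_bigr => i iI; apply: eq_big => [i'|i' /andP[i'I /setD1P[nii' _]]].
    by rewrite !inE iI andbT eq_sym andbC.
  have -> : (j |: I :\ i') :\ i = j |: I :\ i :\ i'.
    apply/setP=> x; rewrite !inE; case: (eqVneq x j) => [->|_] /=; last by rewrite andbCA.
    by rewrite andbT eq_sym (memPn jI).
  apply: bop_comm => //; first by rewrite eq_sym.
    by apply: contraNneq qI => <-.
  by apply: contraNneq jI => ->.
rewrite !opprD !opprK !addrA [RHS](ACl (1*5*2*4*7*6*3)%AC) //=.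
Qed.

(** Every step [bop a j] lowers the value at position j and keeps the value at i. So w(j) < w(i)
    persists, and the last operator [bop i j], which commutes with the part for J, meets no
    cover. *)
Lemma bop_pieri_bop0 i j J I v w : i \notin I -> i \notin J -> j \notin I -> j \notin J ->
  {in I, forall a, a < j}%N -> (i < j)%N -> (w j < w i)%N ->
  pieri (j :: J) I (bop i j v) w = 0.
Proof.
move=> + iJ + jJ + ij; elim/set_ind: I w => I IHI w iI jI lt_I lt_w.
rewrite pieri_cons pieri_bop_comm // ffunE ffunE ifN ?add0r; last first.
  by apply/negP => /covers_lt; lia.
rewrite sum_ffunE big1 // => a aI; rewrite ffunE; case: ifP => // /covers_lt lt_a.
apply: IHI => //; rewrite ?inE ?(negPf iI) ?(negPf jI) ?andbF //.
  by move=> x /setD1P[_ /lt_I].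
have ai : a != i by apply: contraNneq iI => <-.
rewrite !compWE tpermR tpermD //; first lia.
by rewrite -val_eqE /=; lia.
Qed.

(** The defect in [pieri_jucys] cancels against the terms where j has a nonempty list. Shrinking I
    leaves a term with [bop i j] at both ends; it vanishes by [bop_pieri_bop0], because the first
    [bop i j] inverts the values at i and j. *)
Lemma pieri_cons_jucys J I j v : uniq (j :: J) -> {in I, forall i, i < j}%N ->
    {in J, forall q, j < q}%N ->
  pieri (j :: J) I (jucys J I j v) = pieri J (j |: I) v.
Proof.
case/andP=> jJ uJ + ltJ; elim/set_ind: I => I IHI lt_I.
have jI : j \notin I by apply/negP => /lt_I; rewrite ltnn.
rewrite pieri_cons pieri_jucys // -[RHS]addr0 -addrA; congr (_ + _).
rewrite addrC -sumrB big1 // => i iI.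
have -> : jucys J I j v = jucys J (I :\ i) j v - bop i j v.
  by rewrite /jucys (big_setD1 i iI) /= [bop i j v + _]addrC opprD addrA.
rewrite raddfB /= IHI //; last by move=> x /setD1P[_ /lt_I].
rewrite raddfB /= addrAC subrr add0r; apply/ffunP=> w; rewrite !ffunE.
case: ifP => [/covers_lt lt_w|]; last by rewrite oppr0.
rewrite bop_pieri_bop0 ?oppr0 ?lt_I //.
- by rewrite !inE eqxx.
- by apply/negP => /ltJ; have := lt_I i iI; lia.
- by rewrite !inE (negPf jI) andbF.
- by move=> x /setD1P[_ /lt_I].
- by rewrite !compWE tpermL tpermR.
Qed.

End Operators.

(** * The Schubert basis *)

Section Schubert.
Variables (R : realType) (r : nat).
Local Notation W := 'S_r.+1.
Implicit Types (w v x : W) (a b i j : 'I_r.+1).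
Local Notation L i := (@FracField.tofrac (Sring R r) (Lcoord R i)).

(* Evaluation at the sum of the positive coroots, where L_i - L_j takes the value 2 (j - i). *)
Definition rho_eval (f : Sring R r) : R[i] :=
  f.@[fun j : 'I_r => (r%:Z - j.*2%:Z)%:~R].

Lemma rho_eval_Lcoord i : rho_eval (Lcoord R i) = (r%:Z - i.*2%:Z)%:~R.
Proof.
rewrite /Lcoord /rho_eval; case: unliftP => [j ->|->].
  by rewrite lift_max; apply: mevalXU.
rewrite /= mevalN (raddf_sum (meval _)) /= (eq_bigr (fun j : 'I_r => (r%:Z - j.*2%:Z)%:~R)); last first.
  by move=> j _; exact: mevalXU.
rewrite -rmorph_sum -rmorphN /=; congr (_%:~R).
have E n : \sum_(j < n) (r%:Z - j.*2%:Z) = n%:Z * (r%:Z - n%:Z + 1) :> int.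
  by elim: n => [|n IHn]; rewrite ?big_ord0 ?mul0r // big_ord_recr /= IHn; lia.
by rewrite E; lia.
Qed.

Lemma rho_eval_sub i j : rho_eval (Lcoord R i - Lcoord R j) = (j.*2%:Z - i.*2%:Z)%:~R.
Proof.
by rewrite /rho_eval mevalB -!/(rho_eval _) !rho_eval_Lcoord -rmorphB /=; congr _%:~R; lia.
Qed.

Lemma Lcoord_inj : injective (@Lcoord R r).
Proof.
move=> i j /(congr1 rho_eval); rewrite !rho_eval_Lcoord => /(@intr_inj R[i]) E.
by apply: val_inj => /=; lia.
Qed.

Lemma tofrac_Lcoord_neq i j : i != j -> L i - L j != 0.
Proof.
move=> ij; rewrite -raddfB tofrac_eq0 subr_eq0; apply: contra_neq ij; exact: Lcoord_inj.
Qed.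

(** The evaluation [rho_eval] separates the two sets by sign. This makes the product that gives
    xi^e(e) empty. *)
Lemma Delta_neg_disjoint (b : Sring R r) : b \in Delta_pos R r -> b \notin Delta_neg R r.
Proof.
case/mapP => -[i j]; rewrite mem_filter => /andP[ij _] ->; apply/negP.
case/mapP => _ /mapP[[i' j'] + ->]; rewrite mem_filter => /andP[i'j' _].
move=> /(congr1 rho_eval); rewrite opprB !rho_eval_sub => /(@intr_inj R[i]) /=.
by rewrite /= in ij i'j' *; lia.
Qed.

Variables (xi : W -> Omega R r) (hxi : schubert_basis xi).

Lemma bruhat_le_coxlen w v : bruhat_le w v -> (coxlen w <= coxlen v)%N.
Proof.
case/connectP => p pth ->; elim: p w pth => //= u p IHp w /andP[/existsP[a /existsP[b]]].
by case/and3P=> _ _ lt_u /IHp; apply: leq_trans; apply: ltnW.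
Qed.

Lemma xi_id w : w != 1%g -> xi w 1%g = 0.
Proof.
move=> w1; have [_ -> //] := hxi; apply: contra w1 => /bruhat_le_coxlen.
by rewrite coxlen1 leqn0 => /eqP/coxlen_eq0->.
Qed.

Lemma sref_adj a b : b = a.+1 :> nat -> sref r a.+1 = tperm a b.
Proof.
move=> ba; have lt_b := ltn_ord b; congr (tperm _ _); apply: val_inj; rewrite /= pos_val //; lia.
Qed.

Lemma bruhat_lt_adj a b w : b = a.+1 :> nat -> bruhat_lt (w *o tperm a b) w = (w b < w a)%N.
Proof.
move=> ba; apply/andP/idP => [[nw /bruhat_le_coxlen]|lt_w].
  have [lt_w|//|/val_inj/perm_inj E] := ltngtP (w a) (w b); last by rewrite E in ba; lia.
  by rewrite (coxlen_adj ba lt_w) ltnn.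
have E := coxlen_adj_desc ba lt_w; split.
  by apply/eqP => /(congr1 (@coxlen r)); lia.
apply: connect1; apply/existsP; exists a; apply/existsP; exists b.
by rewrite ba ltnSn /compW mulgA tperm2 mul1g eqxx /= -/(compW w _) E ltnSn.
Qed.

(** Condition (3) with its denominator, the nonzero root L_{v(a)} - L_{v(b)}, cleared. *)
Lemma xi_adj a b w v : b = a.+1 :> nat ->
  xi w (v *o tperm a b) - xi w v =
  (L (v a) - L (v b)) * (if (w b < w a)%N then xi (w *o tperm a b) v else 0).
Proof.
move=> ba; have [_ _ _ /(_ w a.+1)] := hxi.
have -> : (1 <= a.+1 <= r)%N by have := ltn_ord b; lia.
move=> /(_ isT) /ffunP/(_ v); rewrite ffunE /alpha (sref_adj ba) bruhat_lt_adj //.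
have -> : pos r a.+1 = a by apply: val_inj; rewrite /= pos_val //; have := ltn_ord a; lia.
have -> : pos r a.+2 = b by apply: val_inj; rewrite /= pos_val //; have := ltn_ord b; lia.
rewrite /actS comp_mpolyB -!/(actS _ _) !actS_Lcoord raddfB /=.
have nz : L (v a) - L (v b) != 0.
  by apply: tofrac_Lcoord_neq; rewrite (inj_eq perm_inj) -val_eqE /= ba; lia.
have -> : (if (w b < w a)%N then xi (w *o tperm a b) v else 0) =
  (if (w b < w a)%N then xi (w *o tperm a b) else 0) v by case: ifP => // _; rewrite ffunE.
by move=> <-; rewrite mulrC divfK.
Qed.

(** Simple reflections generate W. Applied to a difference, this says that two functions with the
    same divided differences and the same value at e coincide; [xi1], the Monk formula and the
    Newton expansion are all proved in this way. *)
Lemma adj_invariant_eq0 (T : nmodType) (f : W -> T) :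
  (forall a b v, b = a.+1 :> nat -> f (v *o tperm a b) = f v) -> f 1%g = 0 ->
  forall v, f v = 0.
Proof.
move=> inv_f f1 v; have [s [ws _ <-]] := reduced_coxlen v; elim/last_ind: s ws => [//|s i IHs].
rewrite /is_word all_rcons => /andP[ir ws]; rewrite wordW_rcons inv_f ?IHs //.
exact: pos_succ.
Qed.

Lemma xi1 v : xi 1%g v = 1.
Proof.
apply/eqP; rewrite -subr_eq0; apply/eqP; move: v.
apply: (@adj_invariant_eq0 _ (fun v => xi 1%g v - 1)) => [a b v ba|].
  by apply/eqP; rewrite -subr_eq0 opprB addrA subrK xi_adj // !perm1 ba ltnNge leqnSn mulr0.
have [_ _ -> _] := hxi; rewrite big_hasC ?rmorph1 ?subrr //.
apply/hasPn => b /Delta_neg_disjoint; apply: contra => /mapP[c cD ->].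
have -> // : actS 1%g c = c.
case/mapP: cD => _ /mapP[[i j] _ ->] ->.
by rewrite /actS comp_mpolyN comp_mpolyB -!/(actS _ _) !actS_Lcoord !perm1.
Qed.

End Schubert.

(** * The equivariant Monk formula *)

Section CoverAdj.
Variable r : nat.
Implicit Types (w : 'S_r.+1) (a b i j : 'I_r.+1).

Lemma tperm_conj w a b i j :
  w *o tperm i j *o tperm a b = w *o tperm a b *o tperm (tperm a b i) (tperm a b j).
Proof.
by rewrite /compW !mulgA; congr (_ * w)%g; rewrite conjgCV tpermV tpermJ.
Qed.

Lemma compW_tpermK w a b : w *o tperm a b *o tperm a b = w.
Proof. by rewrite /compW mulgA tperm2 mul1g. Qed.

Lemma tperm_adj_ltW a b i j : b = a.+1 :> nat -> (i < j)%N -> (i, j) != (a, b) ->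
  (tperm a b i < tperm a b j)%N.
Proof.
move=> ba ij nij; rewrite tperm_adj_lt //; apply/eqP => -[E1 E2].
by rewrite E1 E2 ba in ij; lia.
Qed.

(** The lifting property for covers. Let s be the transposition of a and b. Otherwise w t_ij s would
    have the length of w, although it arises by an ascent from w s, which is longer than w. *)
Lemma covers_asc a b i j w : b = a.+1 :> nat -> (w a < w b)%N -> (i, j) != (a, b) ->
  covers w i j -> ((w *o tperm i j) a < (w *o tperm i j) b)%N.
Proof.
move=> ba lt_w nij cov; set u := w *o _; have [//|lt_u|/val_inj/perm_inj E] := ltngtP (u a) (u b).
  have Eu := coxlen_adj_desc ba lt_u; have Ew := coxlen_adj ba lt_w.
  have lt_ij := covers_lt cov; have /andP[ij /eqP] := cov; rewrite -/u => Ec.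
  have := @coxlen_tperm r _ _ (w *o tperm a b) (tperm_adj_ltW ba ij nij).
  by rewrite -tperm_conj !compWE !tpermK -/u => /(_ lt_ij); lia.
by rewrite E in ba; lia.
Qed.

(** If both ends of a cover have the descent s, multiplying them by s lowers both lengths by one.
    Conversely, [covers_asc] ensures that s remains an ascent at the upper end of a cover of w s. *)
Lemma covers_desc a b i j w : b = a.+1 :> nat -> (w b < w a)%N -> (i < j)%N ->
    (i, j) != (a, b) ->
  covers w i j && ((w *o tperm i j) b < (w *o tperm i j) a)%N =
  covers (w *o tperm a b) (tperm a b i) (tperm a b j).
Proof.
move=> ba lt_w ij nij; have Ew := coxlen_adj_desc ba lt_w.
apply/andP/idP => [[/andP[_ /eqP Ec] lt_u]|cov].
  rewrite /covers tperm_adj_ltW // -tperm_conj /=.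
  by have := coxlen_adj_desc ba lt_u; lia.
have nij' : (tperm a b i, tperm a b j) != (a, b).
  apply/eqP => -[/(canRL (tpermK a b)) E1 /(canRL (tpermK a b)) E2].
  by move: ij; rewrite E1 E2 tpermL tpermR ba; lia.
have lt_w' : ((w *o tperm a b) a < (w *o tperm a b) b)%N by rewrite !compWE tpermL tpermR.
have := covers_asc ba lt_w' nij' cov; rewrite -tperm_conj => lt_u.
have := coxlen_adj ba lt_u; rewrite compW_tpermK => El.
move: lt_u; rewrite !(compWE _ (tperm a b)) tpermL tpermR => lt_u; split=> //.
case/andP: cov => _ /eqP; rewrite -tperm_conj => Ec.
by rewrite /covers ij El Ec Ew /=.
Qed.

End CoverAdj.

Section Monk.
Variables (R : realType) (r : nat).
Local Notation W := 'S_r.+1.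
Implicit Types (w v x : W) (a b i j k : 'I_r.+1).
Local Notation L i := (@FracField.tofrac (Sring R r) (Lcoord R i)).
Variables (xi : W -> Omega R r) (hxi : schubert_basis xi).

(** Antisymmetric in k and j and zero for k = j, so the right side of the Monk formula is one sum
    over all positions, which the simple reflections permute. *)
Definition signed_cover (T : zmodType) (F : W -> T) w k j : T :=
  if covers w k j then F (w *o tperm k j)
  else if covers w j k then - F (w *o tperm k j) else 0.

Lemma signed_cover_gt (T : zmodType) (F : W -> T) w k j : ~~ (k < j)%N ->
  signed_cover F w k j = if covers w j k then - F (w *o tperm j k) else 0.
Proof. by move=> kj; rewrite /signed_cover /covers (negPf kj) tpermC. Qed.

Lemma signed_cover_lt (T : zmodType) (F : W -> T) w k j : (k < j)%N ->
  signed_cover F w k j = if covers w k j then F (w *o tperm k j) else 0.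
Proof. by move=> kj; rewrite /signed_cover /covers kj [(j < k)%N]ltnNge (ltnW kj). Qed.

Lemma signed_coverC (T : zmodType) (F : W -> T) w k j : k != j ->
  signed_cover F w k j = - signed_cover F w j k.
Proof.
rewrite -val_eqE neq_ltn => /orP[kj|kj].
  rewrite signed_cover_lt // [in RHS]signed_cover_gt; last by rewrite -leqNgt ltnW.
  by case: ifP; rewrite ?opprK ?oppr0.
rewrite [in RHS]signed_cover_lt // signed_cover_gt; last by rewrite -leqNgt ltnW.
by case: ifP; rewrite ?oppr0.
Qed.

Lemma signed_coverii (T : zmodType) (F : W -> T) w k : signed_cover F w k k = 0.
Proof. by rewrite /signed_cover /covers ltnn. Qed.

Lemma signed_coverD (T : zmodType) (F G : W -> T) w k j :
  signed_cover (fun v => F v + G v) w k j = signed_cover F w k j + signed_cover G w k j.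
Proof. by rewrite /signed_cover; case: ifP => // _; case: ifP; rewrite ?addr0 ?opprD. Qed.

Lemma signed_coverM (T : pzRingType) (F : W -> T) c w k j :
  signed_cover (fun v => c * F v) w k j = c * signed_cover F w k j.
Proof. by rewrite /signed_cover; case: ifP => // _; case: ifP; rewrite ?mulr0 ?mulrN. Qed.

Lemma signed_cover_asc (T : zmodType) (F : W -> T) a b w k j : b = a.+1 :> nat ->
    (w a < w b)%N -> (k, j) != (a, b) -> (k, j) != (b, a) ->
  signed_cover (fun v => if (v b < v a)%N then F (v *o tperm a b) else 0) w k j = 0.
Proof.
move=> ba lt_w; wlog kj : k j / (k < j)%N => [IH nab nba|].
  have [kj|jk|/val_inj->] := ltngtP k j; [exact: IH| |exact: signed_coverii].
  rewrite signed_coverC ?IH ?oppr0 // -?val_eqE /=; try lia.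
    by apply: contra nba => /eqP[-> ->].
  by apply: contra nab => /eqP[-> ->].
move=> nab _; rewrite signed_cover_lt //; case: ifP => // cov.
by rewrite ltnNge ltnW ?(covers_asc ba lt_w nab).
Qed.

Lemma signed_cover_desc (T : zmodType) (F : W -> T) a b w k j : b = a.+1 :> nat ->
    (w b < w a)%N -> (k, j) != (a, b) -> (k, j) != (b, a) ->
  signed_cover (fun v => if (v b < v a)%N then F (v *o tperm a b) else 0) w k j =
  signed_cover F (w *o tperm a b) (tperm a b k) (tperm a b j).
Proof.
move=> ba lt_w; wlog kj : k j / (k < j)%N => [IH nab nba|].
  have [kj|jk|/val_inj->] := ltngtP k j; [exact: IH| |by rewrite !signed_coverii].
  rewrite signed_coverC -?val_eqE /=; try lia.
  rewrite [RHS]signed_coverC ?(inj_eq perm_inj) -?val_eqE /=; try lia.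
  rewrite IH //.
    by apply: contra nba => /eqP[-> ->].
  by apply: contra nab => /eqP[-> ->].
move=> nab nba; rewrite !signed_cover_lt ?tperm_adj_lt //.
rewrite -(covers_desc ba) // -tperm_conj; by case: (covers w k j).
Qed.

(** This computes the divided difference of the Monk sum. By the lifting property all pairs other
    than {a, b} carry over from w to w s; the pair {a, b} itself produces the multiple of F(w),
    which matches, up to sign, the divided difference of x -> L_{x(k)}. *)
Lemma signed_cover_sum_adj (F : W -> {fraction Sring R r}) a b w k : b = a.+1 :> nat ->
  \sum_j signed_cover (fun v => if (v b < v a)%N then F (v *o tperm a b) else 0) w k j =
  (if (w b < w a)%N then \sum_j signed_cover F (w *o tperm a b) (tperm a b k) j else 0)
  + ((k == a)%:R - (k == b)%:R) * F w.
Proof.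
move=> ba; set G := fun v : W => _.
have nab : a != b by rewrite -val_eqE /= ba; lia.
have ab : (a < b)%N by rewrite ba.
have nba : ~~ (b < a)%N by rewrite -leqNgt ltnW.
have GE v : (v a < v b)%N -> G (v *o tperm a b) = F v.
  by move=> lt_v; rewrite /G !compWE tpermL tpermR lt_v compW_tpermK.
have cov_ab v : covers v a b = (v a < v b)%N.
  apply/idP/idP => [/covers_lt//|lt_v]; by rewrite /covers ab (coxlen_adj ba) /=.
have nw : w a <> w b :> nat by move/val_inj/perm_inj/eqP; rewrite (negPf nab).
have rest c : ((k == a) ==> (c != b)) -> ((k == b) ==> (c != a)) ->
   signed_cover G w k c =
   if (w b < w a)%N then signed_cover F (w *o tperm a b) (tperm a b k) (tperm a b c) else 0.
  move=> ka kb; have nab' : (k, c) != (a, b) by rewrite xpair_eqE negb_and -implybE.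
  have nba' : (k, c) != (b, a) by rewrite xpair_eqE negb_and -implybE.
  case: ltnP => lt_w; first exact: signed_cover_desc.
  by apply: signed_cover_asc => //; rewrite ltn_neqAle lt_w andbT; apply/eqP.
have nb : b == a = false by rewrite eq_sym (negPf nab).
case: (ltngtP (w b) (w a)) rest => [lt_w|lt_w|] rest; last by move=> E; case: nw.
- rewrite [in RHS](reindex_inj (@perm_inj _ (tperm a b))) /=.
  have lt_w' : ((w *o tperm a b) a < (w *o tperm a b) b)%N by rewrite !compWE tpermL tpermR.
  case: (eqVneq k a) rest => [->|ka] rest.
    rewrite (negPf nab) subr0 mul1r (bigD1 b) // [in RHS](bigD1 b) //=.
    rewrite tpermL tpermR (signed_cover_lt _ _ ab) cov_ab ltnNge ltnW //=.
    rewrite (signed_cover_gt _ _ nba) cov_ab lt_w' compW_tpermK add0r addrAC addNr add0r.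
    by apply: eq_bigr => c cb; rewrite rest ?tpermL ?(negPf nab).
  case: (eqVneq k b) rest => [->|kb] rest.
    rewrite sub0r mulN1r (bigD1 a) // [in RHS](bigD1 a) //=.
    rewrite tpermL tpermR (signed_cover_gt _ _ nba) cov_ab [(w a < w b)%N]ltnNge ltnW //=.
    rewrite (signed_cover_lt _ _ ab) cov_ab lt_w' compW_tpermK add0r addrAC subrr add0r.
    by apply: eq_bigr => c ca; rewrite rest ?tpermR ?nb.
  by rewrite subrr mul0r addr0; apply: eq_bigr => c _; apply: rest.
rewrite add0r; case: (eqVneq k a) rest => [->|ka] rest.
  rewrite (negPf nab) subr0 mul1r (bigD1 b) //= (signed_cover_lt _ _ ab) cov_ab lt_w GE //.
  by rewrite big1 ?addr0 // => c cb; rewrite rest ?(negPf nab).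
case: (eqVneq k b) rest => [->|kb] rest.
  rewrite sub0r mulN1r (bigD1 a) //= (signed_cover_gt _ _ nba) cov_ab lt_w GE //.
  by rewrite big1 ?addr0 // => c ca; rewrite rest ?nb.
by rewrite subrr mul0r big1 // => c _; apply: rest.
Qed.

(** Induction on the length of w. Both sides vanish at e. By the Leibniz rule on the left and
    [signed_cover_sum_adj] on the right, equality of the divided differences is the formula for the
    shorter w s at position s(k), or 0 = 0 when s is an ascent of w. *)
Lemma monk w k x :
  (L (w k) - L (x k)) * xi w x = \sum_j signed_cover (fun v => xi v x) w k j.
Proof.
move: {2}(coxlen w).+1 (ltnSn (coxlen w)) => n; elim: n w k x => [//|n IHn] w k x le_n.
apply/eqP; rewrite -subr_eq0; apply/eqP; move: x.
apply: adj_invariant_eq0 => [a b x ba|].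
  (* Here X and X + d * Y are the values of xi^w at x and x s, S is the Monk sum for w, and S' is
     the one for w s, or 0 when s is an ascent of w. *)
  have alg (T : comPzRingType) (lw lx d e X Y S S' : T) : (lw - (lx - d * e)) * Y = S' ->
      (lw - (lx - d * e)) * (X + d * Y) - (S + d * (S' + e * X)) = (lw - lx) * X - S.
    by move=> <-; ring.
  pose d := L (x a) - L (x b).
  pose e : {fraction Sring R r} := (k == a)%:R - (k == b)%:R.
  have Ex v : xi v (x *o tperm a b) = xi v x +
      d * (if (v b < v a)%N then xi (v *o tperm a b) x else 0).
    by rewrite -(xi_adj hxi) // addrC subrK.
  have nab : (a == b) = false by apply/negP => /eqP E; rewrite E in ba; lia.
  have nba : (b == a) = false by rewrite eq_sym nab.
  have Ek : L (x (tperm a b k)) = L (x k) - d * e.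
    rewrite /d /e; case: tpermP => [->|->|/eqP/negPf-> /eqP/negPf->].
    - by rewrite eqxx nab subr0 mulr1 opprB addrC subrK.
    - by rewrite eqxx nba sub0r mulrN1 opprK addrC subrK.
    - by rewrite subrr mulr0 subr0.
  rewrite compWE Ek Ex (eq_bigr _ (fun j _ => congr1 (fun F => signed_cover F w k j) (funext Ex))).
  rewrite (eq_bigr _ (fun j _ => signed_coverD _ _ w k j)) big_split /=.
  rewrite (eq_bigr _ (fun j _ => signed_coverM _ _ w k j)) -mulr_sumr.
  rewrite (@signed_cover_sum_adj (fun v => xi v x) a b w k ba); apply: alg.
  case: ifP => lt_w; last by rewrite mulr0.
  rewrite -IHn; last by move: le_n; rewrite (coxlen_adj_desc ba lt_w).
  by rewrite compWE tpermK Ek.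
have -> : (L (w k) - L ((1%g : W) k)) * xi w 1%g = 0.
  have [->|w1] := eqVneq w 1%g; first by rewrite subrr mul0r.
  by rewrite (xi_id hxi w1) mulr0.
rewrite sub0r big1 ?oppr0 // => j _; rewrite /signed_cover.
have nt i i' : covers w i i' -> xi (w *o tperm i i') 1%g = 0.
  case/andP=> _ /eqP E; apply: xi_id => //; apply/eqP => E1.
  by rewrite E1 coxlen1 in E.
by case: ifP => [/nt//|_]; case: ifP => // /nt; rewrite tpermC => ->; rewrite oppr0.
Qed.

End Monk.

(** * The product of linear factors as a Pieri operator *)

Section ProductFormula.
Variables (R : realType) (r : nat).
Local Notation W := 'S_r.+1.
Implicit Types (w x : W) (a b i j q : 'I_r.+1) (k : nat).
Local Notation L i := (@FracField.tofrac (Sring R r) (Lcoord R i)).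
Local Notation K := {poly {fraction Sring R r}}.

Definition positions_from k : seq 'I_r.+1 := drop k (enum 'I_r.+1).
Definition positions_below k : {set 'I_r.+1} := [set i : 'I_r.+1 | (i < k)%N].

Lemma mem_positions_from k q : (q \in positions_from k) = (k <= q)%N.
Proof.
rewrite -(mem_map val_inj) map_drop val_enum_ord drop_iota mem_iota add0n /=.
by have := ltn_ord q; lia.
Qed.

Lemma positions_from_uniq k : uniq (positions_from k).
Proof. by rewrite drop_uniq ?enum_uniq. Qed.

Lemma positions_from_cons j : positions_from j = j :: positions_from j.+1.
Proof. by rewrite /positions_from (drop_nth j) ?nth_ord_enum // size_enum_ord. Qed.

Lemma positions_below_succ j : positions_below j.+1 = j |: positions_below j.
Proof. by apply/setP=> i; rewrite !inE ltnS leq_eqVlt. Qed.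

Lemma card_positions_below k : (k <= r.+1)%N -> #|positions_below k| = k.
Proof. by move=> kr; rewrite cardsE -sum1_card (big_ord_narrow kr) sum1_card card_ord. Qed.

Lemma pieri_set0 (A : comNzRingType) (y : 'I_r.+1 -> A) J v : pieri y J set0 v = v :> {ffun W -> A}.
Proof.
elim: J => [|q J IHJ]; last by rewrite pieri_cons IHJ big_set0 addr0.
by apply/ffunP => w; rewrite ffunE big_set0 mul1r.
Qed.

Lemma bop_scale (A : comNzRingType) i j (c : A) (v : {ffun W -> A}) :
  bop i j [ffun w => c * v w] = [ffun w => c * bop i j v w].
Proof. by apply/ffunP=> w; rewrite !ffunE; case: ifP; rewrite ?mulr0. Qed.

Lemma pieri_scale (A : comNzRingType) (y : 'I_r.+1 -> A) J I c (v : {ffun W -> A}) :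
  pieri y J I [ffun w => c * v w] = [ffun w => c * pieri y J I v w].
Proof.
elim: J I => [|q J IHJ] I; first by apply/ffunP=> w; rewrite !ffunE mulrCA.
elim/set_ind: I => I IHI; rewrite !pieri_cons IHJ; apply/ffunP=> w.
rewrite !ffunE !sum_ffunE mulrDr mulr_sumr; congr (_ + _); apply: eq_bigr => i iI.
by rewrite IHI // bop_scale ffunE.
Qed.

(** By the Monk formula the Bruhat operators in the Dunkl element add up to y(w(j)) - d. This
    cancels the y(w(j)) of the weight and leaves X - d. *)
Lemma jucys_monk (A : comNzRingType) (y : 'I_r.+1 -> A) (F : W -> A) d j :
    (forall w, (y (w j) - d) * F w = \sum_q signed_cover F w j q) ->
  jucys (fun i => 'X - (y i)%:P) (positions_from j.+1) (positions_below j) j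
    [ffun w => (F w)%:P] = [ffun w => ('X - d%:P) * [ffun w => (F w)%:P] w].
Proof.
move=> monkF; apply/ffunP=> w; set G := finfun _; pose s q := signed_cover F w j q.
have GE v : G v = (F v)%:P by rewrite ffunE.
have bopE i q : bop i q G w = (if covers w i q then F (w *o tperm i q) else 0)%:P.
  by rewrite ffunE GE; case: ifP.
have E1 : \sum_(q <- positions_from j.+1) bop j q G w = (\sum_(q : 'I_r.+1 | (j < q)%N) s q)%:P.
  rewrite raddf_sum big_uniq ?positions_from_uniq //=.
  apply: eq_big => q; rewrite mem_positions_from // => jq.
  by rewrite /s signed_cover_lt // bopE.
have E2 : \sum_(i in positions_below j) bop i j G w = - (\sum_(q : 'I_r.+1 | ~~ (j < q)%N) s q)%:P.
  rewrite -raddfN -sumrN raddf_sum /= [RHS](bigD1 j) ?ltnn //= /s signed_coverii oppr0 raddf0 add0r.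
  apply: eq_big => i; first by rewrite inE -leqNgt ltn_neqAle andbC.
  rewrite inE => ij; have ji : ~~ (j < i)%N by rewrite -leqNgt ltnW.
  rewrite (signed_cover_gt _ _ ji) bopE.
  by case: ifP; rewrite ?opprK ?oppr0.
have E3 : (\sum_(q : 'I_r.+1 | (j < q)%N) s q)%:P + (\sum_(q : 'I_r.+1 | ~~ (j < q)%N) s q)%:P =
    (y (w j) - d)%:P * (F w)%:P.
  by rewrite -rmorphD -rmorphM /= monkF [in RHS](bigID (fun q : 'I_r.+1 => (j < q)%N)).
rewrite /jucys [LHS]ffunE [X in X + _]ffunE [X in _ + X]ffunE !sum_ffunE E1 E2 opprK -addrA E3.
rewrite ffunE big_set1 [RHS]ffunE GE -mulrDl; congr (_ * _).
by rewrite rmorphB addrA subrK.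
Qed.

Variables (xi : W -> Omega R r) (hxi : schubert_basis xi).

Definition linf i : K := 'X - (L i)%:P.
Definition xi_at x : {ffun W -> K} := [ffun w => (xi w x)%:P].

Lemma jucys_xi x j :
  jucys linf (positions_from j.+1) (positions_below j) j (xi_at x) =
  [ffun w => linf (x j) * xi_at x w].
Proof.
exact: (@jucys_monk _ (fun i => L i) (fun w => xi w x) (L (x j)) j (fun w => monk hxi w j x)).
Qed.

Lemma prod_xi_at k x : (k <= r.+1)%N ->
  [ffun w => (\prod_(i in positions_below k) linf (x i)) * xi_at x w] =
  pieri linf (positions_from k) (positions_below k) (xi_at x).
Proof.
elim: k => [_|k IHk lt_k].
  have -> : positions_below 0 = set0 by apply/setP => i; rewrite !inE.
  by rewrite pieri_set0; apply/ffunP=> w; rewrite ffunE big_set0 mul1r.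
(* As an ordinal, j is the position k + 1 of the 1-based numbering. *)
pose j := Ordinal lt_k; rewrite -[k]/(val j) in IHk *.
rewrite positions_below_succ -(@pieri_cons_jucys _ _ _ _ _ j) -?positions_from_cons.
- rewrite jucys_xi pieri_scale -IHk ?(ltnW lt_k) //; apply/ffunP=> w; rewrite !ffunE.
  by rewrite big_setU1 ?inE ?ltnn //= mulrA.
- exact: positions_from_uniq.
- by move=> i; rewrite inE.
- by move=> i; rewrite mem_positions_from.
Qed.

End ProductFormula.

(** * Special superior elements *)

Section Superior.
Variable r : nat.
Local Notation W := 'S_r.+1.
Local Notation cyc := (seq 'I_r.+1 * 'I_r.+1)%type.
Implicit Types (w u : W) (i j q x : 'I_r.+1) (l : seq 'I_r.+1) (z : cyc) (zs : seq cyc).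
Implicit Types (I : {set 'I_r.+1}) (J : seq 'I_r.+1).

Definition dec_rel w : rel 'I_r.+1 := fun i j => (w j < w i)%N.
Definition dj_rel : rel cyc := fun z z' => [disjoint cyc_supp z & cyc_supp z'].
Definition cycles (zs : seq cyc) : W := prodW (map (@cycW r) zs).
Definition degree (zs : seq cyc) : nat := sumn (map (@cyc_deg r) zs).

Lemma compWA (x y z : W) : x *o (y *o z) = x *o y *o z.
Proof. by rewrite /compW mulgA. Qed.

Lemma dec_rel_trans w : transitive (dec_rel w).
Proof. by move=> y x z; rewrite /dec_rel => yx zy; apply: ltn_trans yx. Qed.

Lemma eq_in_dec_path w w' q l : {in q :: l, w =1 w'} ->
  path (dec_rel w) q l = path (dec_rel w') q l.
Proof.
move=> eq_w; apply: (@eq_in_path _ (mem (q :: l))); last exact/allP.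
by move=> x y xl yl; rewrite /dec_rel !eq_w.
Qed.

(** Since (w t_iq)(q) = w(i), the condition on the tail is of the same kind for the new permutation
    and the same q. Special cycles can thus be built one transposition at a time. *)
Lemma dec_path_cons w i q l :
  path (dec_rel w) q (i :: l) =
  [&& (w i < w q)%N, i \notin l, q \notin l & path (dec_rel (w *o tperm i q)) q l].
Proof.
rewrite /= {1}/dec_rel; case: ltnP => //= lt_iq.
have niq : i != q by apply: contraTneq lt_iq => ->; rewrite ltnn.
apply/idP/and3P => [pil|[il ql]].
  have min_l := order_path_min (@dec_rel_trans w) pil.
  have il : i \notin l by apply/negP => /(allP min_l); rewrite /dec_rel ltnn.
  have ql : q \notin l.
    by apply/negP => /(allP min_l); rewrite /dec_rel => lt_qi; have := ltn_trans lt_iq lt_qi; rewrite ltnn.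
  split=> //; case: l pil il ql {min_l} => // x l.
  rewrite /= !inE !negb_or => /andP[xi pxl] /andP[nix il] /andP[nqx ql].
  rewrite {1}/dec_rel !compWE tpermR tpermD //; apply/andP; split => //.
  rewrite -(@eq_in_dec_path w) // => y; rewrite inE => yl; rewrite compWE tpermD //.
    by case/predU1P: yl => [->//|yl]; apply: contraNneq il => ->.
  by case/predU1P: yl => [->//|yl]; apply: contraNneq ql => ->.
case: l il ql => // x l; rewrite /= !inE !negb_or => /andP[nix il] /andP[nqx ql].
rewrite {1}/dec_rel !compWE tpermR tpermD // => /andP[xi pxl]; apply/andP; split => //.
rewrite (@eq_in_dec_path _ (w *o tperm i q)) // => y; rewrite inE => yl; rewrite compWE tpermD //.
  by case/predU1P: yl => [->//|yl]; apply: contraNneq il => ->.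
by case/predU1P: yl => [->//|yl]; apply: contraNneq ql => ->.
Qed.

Lemma cycW_cons i l q : cycW (i :: l, q) = tperm i q *o cycW (l, q).
Proof. by []. Qed.

Lemma cycW_out z x : x \notin cyc_supp z -> cycW z x = x.
Proof.
case: z => l q; elim: l => [|i l IHl]; first by rewrite /cycW /= perm1.
rewrite cycW_cons !inE !negb_or => /and3P[xq xi xl].
by rewrite compWE IHl ?inE ?negb_or ?xq // tpermD // eq_sym.
Qed.

Lemma cycW_in z x : x \in cyc_supp z -> cycW z x \in cyc_supp z.
Proof.
case: z => l q; elim: l x => [|i l IHl] x; first by rewrite /cycW /= perm1.
rewrite cycW_cons compWE => xs.
have : cycW (l, q) x \in cyc_supp (i :: l, q).
  have [/IHl|xl] := boolP (x \in cyc_supp (l, q)); last by rewrite cycW_out.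
  by rewrite !inE => /orP[->|->]; rewrite ?orbT.
by case: tpermP => // -> _; rewrite !inE eqxx ?orbT.
Qed.

Lemma cycW_comm z z' : dj_rel z z' -> cycW z *o cycW z' = cycW z' *o cycW z.
Proof.
move=> dj; apply/permP => x; rewrite !compWE.
have [xz|xz] := boolP (x \in cyc_supp z).
  by rewrite (@cycW_out z' x) ?(disjointFr dj xz) // (@cycW_out z') ?(disjointFr dj (cycW_in xz)).
rewrite (cycW_out xz); have [xz'|xz'] := boolP (x \in cyc_supp z').
  by rewrite cycW_out ?(disjointFl dj (cycW_in xz')).
by rewrite (cycW_out xz') cycW_out.
Qed.

Lemma dj_relC z z' : dj_rel z z' = dj_rel z' z.
Proof. exact: disjoint_sym. Qed.

Lemma cycles_front s1 z s2 : all (dj_rel z) s1 ->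
  cycles (s1 ++ z :: s2) = cycW z *o cycles (s1 ++ s2).
Proof.
elim: s1 => //= z1 s1 IHs /andP[dj /IHs E]; rewrite /cycles /= -!/(cycles _) E.
by rewrite !compWA (cycW_comm dj).
Qed.

Lemma cycles_out zs x : all (fun z => x \notin cyc_supp z) zs -> cycles zs x = x.
Proof.
elim: zs => [|z zs IHzs] /=; first by rewrite /cycles /= perm1.
by case/andP=> xz /IHzs E; rewrite /cycles /= compWE -/(cycles _) E cycW_out.
Qed.

Lemma pairwise_dj_front s1 z s2 :
  pairwise dj_rel (s1 ++ z :: s2) =
  [&& all (dj_rel z) (s1 ++ s2) & pairwise dj_rel (s1 ++ s2)].
Proof.
rewrite !pairwise_cat allrel_consr /= all_cat.
rewrite (eq_all (a1 := dj_rel^~ z) (a2 := dj_rel z)); last by move=> z'; apply: dj_relC.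
by case: (allrel _ s1 s2); case: (all _ s1); case: (all _ s2); case: (pairwise _ s1); case: (pairwise _ s2).
Qed.

Lemma degree_front s1 z s2 : degree (s1 ++ z :: s2) = (cyc_deg z + degree (s1 ++ s2))%N.
Proof. by rewrite /degree !map_cat !sumn_cat /= addnCA. Qed.

(** Conditions (i) and (ii) for one cycle, without the length. The list may be empty, so that a
    recursion can strip a cycle of all its transpositions. *)
Definition admissible J I w z : bool :=
  [&& z.2 \in J, all (mem I) z.1 & path (dec_rel w) z.2 z.1].

(** The length is prescribed for the whole product; [superiorP] recovers condition (iii) for the
    single cycles from the lower bounds on lengths. *)
Definition superior_in J I w u : Prop :=
  exists zs, [/\ all (admissible J I w) zs, pairwise dj_rel zs,
    u = w *o cycles zs & coxlen u = (coxlen w + degree zs)%N].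

Definition precede I J := forall i j, i \in I -> j \in J -> (i < j)%N.

Lemma coxlen_cycW J I w z : precede I J -> admissible J I w z ->
  (coxlen w + cyc_deg z <= coxlen (w *o cycW z))%N.
Proof.
case: z => l q ltIJ /and3P[/= qJ lI]; rewrite /cyc_deg /=.
elim: l w lI => [|i l IHl] w /=; first by rewrite /cycW /compW /= mul1g addn0.
case/andP=> iI lI; rewrite -/(path (dec_rel w) q (i :: l)) dec_path_cons => /and4P[lt_iq _ _ p].
rewrite cycW_cons compWA; have := coxlen_tperm (ltIJ _ _ iI qJ) lt_iq.
by have := IHl _ lI p; lia.
Qed.

Lemma eq_in_admissible J I w w' z : {in cyc_supp z, w =1 w'} ->
  admissible J I w z = admissible J I w' z.
Proof. by move=> eq_w; rewrite /admissible (eq_in_dec_path eq_w). Qed.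

Lemma admissible_cycW J I w z zs : all (dj_rel z) zs ->
  all (admissible J I (w *o cycW z)) zs = all (admissible J I w) zs.
Proof.
move=> dj; apply: eq_in_all => z' z's; apply: eq_in_admissible => x xz'.
by rewrite compWE cycW_out // (disjointFl (allP dj _ z's) xz').
Qed.

(** Every transposition is an ascent where it is applied, since disjoint cycles leave the values on
    each other's supports alone. Prescribing the length of the product is thus the extremal case and
    determines all intermediate lengths. *)
Lemma coxlen_cycles J I w zs : precede I J -> all (admissible J I w) zs ->
  pairwise dj_rel zs -> (coxlen w + degree zs <= coxlen (w *o cycles zs))%N.
Proof.
move=> ltIJ; elim: zs w => [|z zs IHzs] w /=.
  by rewrite /cycles /compW /= mul1g addn0.
case/andP=> adm_z adm /andP[dj pw]; have := coxlen_cycW ltIJ adm_z.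
rewrite -(admissible_cycW _ _ _ dj) in adm; have := IHzs _ adm pw.
rewrite /cycles /degree /= -/(cycles _) -/(degree _) compWA; lia.
Qed.

End Superior.

(** * Superior elements built by successive covers *)

Section SuperiorRec.
Variable r : nat.
Local Notation W := 'S_r.+1.
Local Notation cyc := (seq 'I_r.+1 * 'I_r.+1)%type.
Implicit Types (w u : W) (i j q x : 'I_r.+1) (l : seq 'I_r.+1) (z : cyc) (zs : seq cyc).
Implicit Types (I : {set 'I_r.+1}) (J : seq 'I_r.+1).

Lemma precede_notin I J q : precede I (q :: J) -> q \notin I.
Proof. by move=> ltIJ; apply/negP => /ltIJ/(_ (mem_head _ _)); rewrite ltnn. Qed.

Lemma precede_notin_seq I J i : precede I J -> i \in I -> i \notin J.
Proof. by move=> ltIJ iI; apply/negP => /(ltIJ _ _ iI); rewrite ltnn. Qed.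

Lemma precede_cons I J q : precede I (q :: J) -> precede I J.
Proof. by move=> ltIJ i j iI jJ; apply: ltIJ; rewrite ?inE ?jJ ?orbT. Qed.

Lemma precede_setD1 I J i : precede I J -> precede (I :\ i) J.
Proof. by move=> ltIJ a j /setD1P[_ aI]; apply: ltIJ. Qed.

Lemma degree_cons l q zs : degree ((l, q) :: zs) = (size l + degree zs)%N.
Proof. by []. Qed.

(** Disjoint supports allow at most one cycle through q, and it commutes with the others. If there
    is none, the empty list stands for it. *)
Lemma superior_in_front q J I w u : precede I (q :: J) -> q \notin J ->
  superior_in (q :: J) I w u ->
  exists l zs, [/\ all (admissible J I w) zs, admissible [:: q] I w (l, q),
    all (dj_rel (l, q)) zs /\ pairwise (@dj_rel r) zs, u = w *o (cycW (l, q) *o cycles zs)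
    & coxlen u = (coxlen w + (size l + degree zs))%N].
Proof.
move=> ltIJ qJ [zs [adm pw Eu El]].
have [/hasP[z zzs /eqP zq]|] := boolP (has (fun z => z.2 == q) zs); last first.
  move/hasPn=> nq; exists [::], zs; split=> //.
  - apply/allP => z zzs; have /and3P[] := allP adm _ zzs.
    by rewrite inE (negPf (nq _ zzs)) => /= zJ zI p; apply/and3P.
  - by apply/and3P; rewrite inE eqxx.
  - split=> //; apply/allP => z zzs; rewrite /dj_rel disjoint_cons disjoint0 andbT.
    have /and3P[] := allP adm _ zzs; rewrite inE (negPf (nq _ zzs)) /= => _ zI _.
    rewrite inE negb_or eq_sym (nq _ zzs); apply/negP => /(allP zI).
    by rewrite /= (negPf (precede_notin ltIJ)).
  - by rewrite Eu /cycW /= /compW mulg1.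
case/splitPr: zzs adm pw Eu El => s1 s2; rewrite pairwise_dj_front degree_front.
rewrite [all (admissible _ _ _) _]all_cat /= => /and3P[adm1 admz adm2] /andP[dj pw] Eu El.
case: z zq admz dj Eu El => l q' /= -> admz dj Eu El.
exists l, (s1 ++ s2); split=> //.
- have : all (admissible (q :: J) I w) (s1 ++ s2) by rewrite all_cat adm1.
  move=> adm; apply/allP => z zs12; have /and3P[] := allP adm _ zs12.
  have := allP dj _ zs12; rewrite /dj_rel disjoint_cons => /andP[+ _].
  rewrite !inE negb_or eq_sym => /andP[/negPf-> _] /= zJ zI p; exact/and3P.
- by case/and3P: admz => _ zI p; apply/and3P; rewrite inE eqxx.
- by rewrite Eu cycles_front //; move: dj; rewrite all_cat => /andP[].
Qed.

Lemma superior_in_nil I w u : superior_in [::] I w u <-> u = w.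
Proof.
split=> [[[|z zs] [//= _ _ -> _]]|->]; first by rewrite /cycles /compW /= mul1g.
by exists [::]; rewrite /cycles /degree /compW /= mul1g addn0.
Qed.

Lemma superior_in_consW q J I w u : superior_in J I w u -> superior_in (q :: J) I w u.
Proof.
case=> zs [adm pw Eu El]; exists zs; split=> //; apply: sub_all adm => z.
by case/and3P=> zJ zI p; apply/and3P; rewrite inE zJ orbT.
Qed.

(** The counterpart of [pieri_cons] for elements of W, with i the first entry of the list at q. *)
Lemma superior_in_cons q J I w u : precede I (q :: J) -> q \notin J ->
  superior_in (q :: J) I w u <->
  superior_in J I w u \/
  exists2 i, i \in I & covers w i q /\ superior_in (q :: J) (I :\ i) (w *o tperm i q) u.
Proof.
move=> ltIJ qJ; have qI := precede_notin ltIJ; split.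
  case/(superior_in_front ltIJ qJ) => -[|i l] [zs [adm adm_l [dj pw] Eu El]].
    left; exists zs; split=> //; by rewrite Eu /cycW /= /compW mulg1.
  right; have /and3P[_ /= /andP[iI lI]] := adm_l.
  rewrite -/(path _ q (i :: l)) dec_path_cons => /and4P[lt_iq il ql p].
  have lI' : all (mem (I :\ i)) l.
    apply/allP => x xl; rewrite !inE [x \in I](allP lI) // andbT.
    by apply: contraNneq il => <-.
  have eq_w z : z \in zs -> {in cyc_supp z, w *o tperm i q =1 w}.
    move=> /(allP dj); rewrite /dj_rel !disjoint_cons => /and3P[qz iz _] x xz.
    rewrite compWE tpermD //; first by apply: contraNneq iz => ->.
    by apply: contraNneq qz => ->.
  have adm1 : all (admissible (q :: J) (I :\ i) (w *o tperm i q)) ((l, q) :: zs).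
    apply/andP; split; first by apply/and3P; rewrite mem_head.
    apply/allP => z zzs; have /and3P[zJ zI pz] := allP adm _ zzs.
    apply/and3P; split; first by rewrite inE zJ orbT.
      apply/allP => x xz; rewrite !inE [x \in I](allP zI) // andbT.
      have := allP dj _ zzs; rewrite /dj_rel !disjoint_cons => /and3P[_ + _].
      by apply: contraNneq => <-; rewrite inE xz orbT.
    by rewrite (@eq_in_dec_path r _ w) //; apply: eq_w.
  have pw1 : pairwise (@dj_rel r) ((l, q) :: zs).
    rewrite /= pw andbT; apply: sub_all dj => z.
    by rewrite /dj_rel !disjoint_cons => /and3P[-> _ ->].
  have Eu1 : u = (w *o tperm i q) *o cycles ((l, q) :: zs).
    by rewrite Eu cycW_cons /cycles /= !compWA.
  have := coxlen_cycles (precede_setD1 ltIJ) adm1 pw1; rewrite -Eu1 El.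
  have := coxlen_tperm (ltIJ _ _ iI (mem_head _ _)) lt_iq.
  rewrite degree_cons /= => lt1 le1.
  (* The first step adds at least one to the length and the rest at least its degree. The total
     leaves no slack, so the first step is a cover. *)
  have Ec : coxlen (w *o tperm i q) = (coxlen w).+1 by clear - lt1 le1; lia.
  exists i; first exact: iI.
  split; first by rewrite /covers Ec eqxx (ltIJ _ _ iI (mem_head _ _)).
  exists ((l, q) :: zs); split; [exact: adm1|exact: pw1|exact: Eu1|].
  by rewrite El Ec degree_cons /= !addSn addnS.
case=> [|[i iI [cov]]]; first exact: superior_in_consW.
case/(superior_in_front (precede_setD1 ltIJ) qJ) => l [zs [adm adm_l [dj pw] Eu El]].
have /and3P[_ /= lI p] := adm_l.
have notI' : forall l', all (mem (I :\ i)) l' -> i \notin l'.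
  by move=> l' l'I; apply/negP => /(allP l'I); rewrite /= !inE eqxx.
have sub_I : forall l', all (mem (I :\ i)) l' -> all (mem I) l'.
  by move=> l'; apply: sub_all => x /setD1P[].
have iJ : i \notin J by apply: precede_notin_seq (precede_cons ltIJ) iI.
have iz z : z \in zs -> i \notin cyc_supp z.
  move=> /(allP adm)/and3P[zJ zI _]; rewrite inE negb_or notI' // andbT.
  by apply: contraNneq iJ => ->.
exists ((i :: l, q) :: zs); split.
- apply/andP; split.
    apply/and3P; split; rewrite ?mem_head //=; first by rewrite iI sub_I.
    rewrite -/(path _ q (i :: l)) dec_path_cons p (covers_lt cov) notI' //= andbT.
    by apply/negP => /(allP (sub_I _ lI)); rewrite /= (negPf qI).
  apply/allP => z zzs; have /and3P[zJ zI pz] := allP adm _ zzs.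
  apply/and3P; split; rewrite ?inE ?zJ ?orbT ?sub_I //.
  rewrite (@eq_in_dec_path r _ (w *o tperm i q)) // => x xz; rewrite compWE tpermD //.
    by apply: contraNneq (iz _ zzs) => ->.
  have := allP dj _ zzs; rewrite /dj_rel disjoint_cons => /andP[+ _].
  by apply: contraNneq => ->.
- rewrite /= pw andbT; apply/allP => z zzs.
  have := allP dj _ zzs; rewrite /dj_rel !disjoint_cons => /andP[-> ->].
  by rewrite iz.
- by rewrite Eu /cycles /= cycW_cons !compWA.
- case/andP: cov => _ /eqP Ec; by rewrite El Ec degree_cons /= !addSn addnS.
Qed.

Lemma superior_in_out J I w u x : superior_in J I w u -> x \notin I -> x \notin J -> u x = w x.
Proof.
case=> zs [adm _ -> _] xI xJ; rewrite compWE cycles_out //; apply: sub_all adm => z.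
case/and3P=> zJ zI _; rewrite inE negb_or; apply/andP; split.
  by apply: contraNneq xJ => ->.
by apply/negP => /(allP zI); rewrite /= (negPf xI).
Qed.

End SuperiorRec.

(** * The Pieri operator as a sum over superior elements *)

Section Expansion.
Variable r : nat.
Local Notation W := 'S_r.+1.
Local Notation cyc := (seq 'I_r.+1 * 'I_r.+1)%type.
Implicit Types (w u : W) (i j q x : 'I_r.+1) (z : cyc) (zs : seq cyc).
Implicit Types (I : {set 'I_r.+1}) (J : seq 'I_r.+1).

(** Position i is used up by the step. As u(i) = w(q) determines i, an element u comes from at most
    one first step. *)
Lemma superior_step_at q J I w u i : precede I (q :: J) -> i \in I ->
  superior_in (q :: J) (I :\ i) (w *o tperm i q) u -> u i = w q.
Proof.
move=> ltIJ iI su; rewrite (superior_in_out (x := i) su) ?compWE ?tpermL //.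
  by rewrite !inE eqxx.
exact: precede_notin_seq ltIJ iI.
Qed.

Lemma superior_step_fixed q J I w u i i' : precede I (q :: J) -> i \in I ->
    superior_in (q :: J) (I :\ i) (w *o tperm i q) u ->
  (i' \in I) && (u i' == w i') =
  (i' \in I :\ i) && (u i' == (w *o tperm i q) i').
Proof.
move=> ltIJ iI su; have ui := superior_step_at ltIJ iI su.
have qI := precede_notin ltIJ.
rewrite !inE; have [->|ni] := eqVneq i' i; rewrite ?iI /=.
  by rewrite ui (inj_eq perm_inj); apply/negbTE; apply: contraNneq qI => ->.
case: (boolP (i' \in I)) => //= i'I; rewrite compWE tpermD //; first by rewrite eq_sym.
by apply: contraNneq qI => ->.
Qed.

(** The recursions [pieri_cons] and [superior_in_cons] run in parallel. The point is that their
    alternatives exclude one another, so that every u is counted once. *)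
Lemma pieri_expand (K : comNzRingType) (y : 'I_r.+1 -> K) J I v w : precede I J -> uniq J ->
  pieri y J I v w =
    \sum_(u | `[< superior_in J I w u >]) (\prod_(i in I | u i == w i) y (w i)) * v u.
Proof.
elim: J I w => [|q J IHJ] I w.
  move=> _ _; rewrite (big_pred1 w) => [|u]; last first.
    by apply/asboolP/eqP; rewrite superior_in_nil.
  by rewrite ffunE; congr (_ * _); apply: eq_bigl => i; rewrite eqxx andbT.
move=> + /andP[qJ uJ]; elim/set_ind: I w => I IHI w ltIJ.
have qI := precede_notin ltIJ.
rewrite pieri_cons ffunE sum_ffunE IHJ //; last exact: precede_cons ltIJ.
pose F I w u := (\prod_(i in I | u i == w i) y (w i)) * v u.
pose S i u := covers w i q && `[< superior_in (q :: J) (I :\ i) (w *o tperm i q) u >].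
have Ei i : i \in I -> bop i q (pieri y (q :: J) (I :\ i) v) w =
    \sum_u if S i u then F (I :\ i) (w *o tperm i q) u else 0.
  move=> iI; rewrite ffunE /S; case: (covers w i q); last by rewrite big1.
  by rewrite IHI // ?big_mkcond //; apply: precede_setD1.
rewrite (eq_bigr _ Ei) exchange_big /= [X in X + _]big_mkcond -big_split /= [RHS]big_mkcond.
apply: eq_bigr => u _ /=; rewrite -!/(F _ _ u).
have su i : i \in I -> S i u -> u i = w q.
  by move=> iI /andP[_ /asboolP]; apply: superior_step_at.
have FE i : i \in I -> S i u -> F (I :\ i) (w *o tperm i q) u = F I w u.
  move=> iI /andP[_ /asboolP s]; congr (_ * _); apply/esym.
  apply: eq_big => [i'|i' cond]; first exact: (superior_step_fixed i' ltIJ iI s).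
  have := cond; rewrite (superior_step_fixed i' ltIJ iI s) => /andP[_ /eqP<-].
  by case/andP: cond => _ /eqP->.
have sup_cons := superior_in_cons w u ltIJ qJ.
case: (asboolP (superior_in J I w u)) => [sJ|nsJ].
  have -> : `[< superior_in (q :: J) I w u >] by apply/asboolP/sup_cons; left.
  (* Without a cycle at q one has u(q) = w(q), while a first step at i would give u(i) = w(q). *)
  rewrite big1 ?addr0 // => i iI; case: ifP => // /(su i iI) ui.
  have uq : u q = w q by apply: superior_in_out sJ _ _.
  by move: qI; rewrite (perm_inj (etrans uq (esym ui))) iI.
rewrite add0r; case: asboolP => [/sup_cons[//|[i iI [cov si]]]|ns].
  have Si : S i u by rewrite /S cov; apply/asboolP.
  rewrite (bigD1 i iI) /= Si FE // big1 ?addr0 // => i' /andP[i'I ni].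
  case: ifP => // /(su i' i'I) ui'; move: ni.
  by rewrite -(inj_eq (@perm_inj _ u)) ui' (su i iI Si) eqxx.
rewrite big1 // => i iI; case: ifP => // /andP[cov /asboolP si].
by case: ns; apply/sup_cons; right; exists i.
Qed.

Lemma superior_in_coxlen J I w u : precede I J -> uniq J -> superior_in J I w u ->
  coxlen u = (coxlen w + #|[set i in I | u i != w i]|)%N.
Proof.
elim: J I w => [|q J IHJ] I w.
  move=> _ _ /superior_in_nil->; rewrite eq_card0 ?addn0 // => i.
  by rewrite inE eqxx andbF.
move=> + /andP[qJ uJ]; elim/set_ind: I w => I IHI w ltIJ.
case/(superior_in_cons w u ltIJ qJ) => [sJ|[i iI [cov si]]].
  exact: IHJ (precede_cons ltIJ) uJ sJ.
rewrite (IHI i iI _ (precede_setD1 ltIJ) si); case/andP: cov => _ /eqP->.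
rewrite (cardsD1 i [set i' in I | _]) inE iI (superior_step_at ltIJ iI si).
have -> : w q != w i.
  by rewrite (inj_eq perm_inj); apply: contraNneq (precede_notin ltIJ) => ->.
rewrite add1n addSnnS; congr (_ + _.+1)%N; apply: eq_card => i'; rewrite !inE.
have := superior_step_fixed i' ltIJ iI si; rewrite !inE.
by case: (i' =P i) => //= _; case: (i' \in I) => //= ->.
Qed.

Lemma cycles_filter zs : cycles [seq z <- zs | (0 < cyc_deg z)%N] = cycles zs.
Proof.
elim: zs => //= -[[|i l] q] zs IHzs; last by rewrite /cycles /= -/(cycles _) IHzs.
by rewrite /= IHzs /cycles /= /compW {2}/cycW /= mulg1.
Qed.

Lemma degree_filter zs : degree [seq z <- zs | (0 < cyc_deg z)%N] = degree zs.
Proof.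
elim: zs => //= -[[|i l] q] zs IHzs; first exact: IHzs.
by rewrite degree_cons -IHzs.
Qed.

Lemma precede_positions k : precede (positions_below r k) (positions_from r k).
Proof. by move=> i j; rewrite inE mem_positions_from => ik kj; apply: leq_trans kj. Qed.

Lemma superiorP k p w u :
  superior k p w u <->
  superior_in (positions_from r k) (positions_below r k) w u /\ coxlen u = (coxlen w + p)%N.
Proof.
set J := positions_from r k; set I := positions_below r k.
have ltIJ : precede I J by apply: precede_positions.
split=> [[zs [adm pw Ep Eu El]]|[[zs [adm pw Eu El]] Ep]].
  split=> //; exists zs; split=> //; last by rewrite El -Ep.
  apply: sub_all adm => z /and4P[_ /andP[zI zJ] pz _]; apply/and3P; split=> //.
    by rewrite mem_positions_from.
  by apply: sub_all zI => i; rewrite /= inE.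
exists [seq z <- zs | (0 < cyc_deg z)%N]; split=> //; last 1 first.
- by rewrite -/(cycles _) cycles_filter.
- apply/allP => z; rewrite mem_filter => /andP[z0 zzs].
  have adm_z := allP adm _ zzs; apply/and4P; split=> //.
  + case/and3P: adm_z; rewrite mem_positions_from => -> zI _; rewrite andbT.
    by apply: sub_all zI => i; rewrite /= inE.
  + by case/and3P: adm_z.
  (* With z moved to the front, the lower bound for the remaining cycles leaves at most the degree
     of z for the growth caused by z. *)
  have le_z := coxlen_cycW ltIJ adm_z.
  case/splitPr: zzs adm pw Eu El => s1 s2; rewrite pairwise_dj_front degree_front.
  move=> adm /andP[dj pw] Eu El.
  have adm' : all (admissible J I (w *o cycW z)) (s1 ++ s2).
    rewrite admissible_cycW //; apply/allP => z' z's; apply: (allP adm).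
    by move: z's; rewrite !mem_cat inE => /orP[->|->]; rewrite ?orbT.
  have := coxlen_cycles ltIJ adm' pw; rewrite -compWA -cycles_front; last first.
    by move: dj; rewrite all_cat => /andP[].
  rewrite -Eu El addnA leq_add2r => le_z'.
  by rewrite eqn_leq; apply/andP; split; [exact: le_z'|exact: le_z].
- exact: pairwise_filter.
- rewrite -/(degree _) degree_filter; move: Ep; rewrite El; clear; lia.
Qed.

End Expansion.

(** * The elements c[k,m] and v[u,w,k] *)

Section SpecialElements.
Variable r : nat.
Local Notation W := 'S_r.+1.
Implicit Types (w u : W) (i j q x : 'I_r.+1) (k m : nat).

Lemma sref_val k x : (0 < k <= r)%N ->
  sref r k x = (if x == k.-1 :> nat then k else if x == k :> nat then k.-1 else x) :> nat.
Proof.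
case/andP=> k0 kr; have Ep : pos r k = k.-1 :> nat by rewrite pos_val //; lia.
have Es : pos r k.+1 = k :> nat by rewrite pos_val.
rewrite /sref; case: tpermP => [->|->|/eqP + /eqP]; rewrite -?val_eqE /= ?Ep ?Es ?eqxx //.
  by case: eqP => // E; lia.
by move=> /negPf-> /negPf->.
Qed.

Lemma c_elt0 k : c_elt r k 0 = 1%g.
Proof. by []. Qed.

Lemma c_elt_succ k m : (m <= k)%N -> c_elt r k.+1 m.+1 = c_elt r k m *o sref r k.+1.
Proof.
move=> mk; rewrite -wordW_rcons /c_elt subSS -cats1; congr (wordW r _).
by rewrite -[m.+1]addn1 iotaD /=; congr (_ ++ [:: _]); lia.
Qed.

(** In 0-based positions this is the cycle k-m -> k-m+1 -> ... -> k -> k-m. For m > 0 its only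
    descent is s_k, so by condition (3) the function xi^{c[k,m]} responds to s_k alone. *)
Lemma c_elt_val k m x : (m <= k)%N -> (k <= r)%N ->
  c_elt r k m x = (if (x < k - m)%N then x : nat else if (x < k)%N then x.+1
                   else if x == k :> nat then k - m else x)%N :> nat.
Proof.
elim: k m x => [|k IHk] [|m] x // mk kr; rewrite ?c_elt0 ?perm1.
- by rewrite subn0; case: eqP.
- by rewrite subn0; case: ltngtP.
rewrite c_elt_succ // compWE IHk ?(ltnW kr) // sref_val //= subSS.
case: (ltngtP x k) => xk; case: (ltngtP x k.+1) => xk1 //; repeat case: ifP; lia.
Qed.

Lemma c_elt_asc k m (a b : 'I_r.+1) : b = a.+1 :> nat -> (m <= k)%N -> (k <= r)%N -> b != k :> nat ->
  (c_elt r k m a < c_elt r k m b)%N.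
Proof. by move=> ba mk kr bk; rewrite !c_elt_val //; repeat case: ifP; lia. Qed.

Lemma c_elt_desc k m (a b : 'I_r.+1) : b = a.+1 :> nat -> (0 < m <= k)%N -> b = k :> nat -> (k <= r)%N ->
  (c_elt r k m b < c_elt r k m a)%N.
Proof. by move=> ba mk bk kr; rewrite !c_elt_val //; repeat case: ifP; lia. Qed.

Lemma prodW_fix (s : seq W) x : {in s, forall t : W, t x = x} -> prodW s x = x.
Proof.
elim: s => [|t s IHs] fix_s /=; first by rewrite perm1.
rewrite compWE IHs => [|y ys]; first by rewrite fix_s ?mem_head.
by rewrite fix_s // inE ys orbT.
Qed.

Lemma word_rev_iota_start (j l : nat) x : (0 < j)%N -> (j + l <= r.+1)%N -> x = j.-1 :> nat ->
  wordW r (rev (iota j l)) x = (j.-1 + l)%N :> nat.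
Proof.
move=> j0; elim: l => [|l IHl] le_r xj; first by rewrite perm1 addn0.
rewrite -[l.+1]addn1 iotaD rev_cat /= /wordW /= compWE sref_val ?IHl //; try lia.
by case: ifP; lia.
Qed.

Lemma word_rev_iota_fix (j l : nat) x : (0 < j)%N -> (j + l <= r.+1)%N ->
  (x < j.-1)%N || (j + l <= x)%N -> wordW r (rev (iota j l)) x = x.
Proof.
move=> j0; elim: l => [|l IHl] le_r xj; first by rewrite perm1.
apply: val_inj; rewrite -[l.+1]addn1 iotaD rev_cat /= /wordW /= compWE sref_val; last lia.
by rewrite -/(wordW _ _) IHl; [case: ifP; [lia|case: ifP; lia]|lia|lia].
Qed.

Lemma movedE u w k : moved u w k = [set i : 'I_r.+1 | (i < k)%N && (u i != w i)].
Proof.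
by apply/setP => i; rewrite !inE compWE -(inj_eq (@perm_inj _ w)) permKV.
Qed.

(** The increasing list whose reverse is [unmoved_seq]: its entry of index j, counted from 0, is
    r_{k-p-j}. *)
Definition unmoved u w k : seq 'I_r.+1 :=
  [seq i : 'I_r.+1 <- enum 'I_r.+1 | (i < k)%N && (i \notin moved u w k)].

Lemma unmoved_sorted u w k : sorted ltn (map val (unmoved u w k)).
Proof.
apply: (subseq_sorted ltn_trans (s2 := map val (enum 'I_r.+1))).
  exact/map_subseq/filter_subseq.
by rewrite val_enum_ord iota_ltn_sorted.
Qed.

Lemma mem_unmoved u w k i : (i \in unmoved u w k) = (i < k)%N && (u i == w i).
Proof.
rewrite mem_filter mem_enum andbT movedE inE; by case: (i < k)%N => //=; rewrite negbK.
Qed.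

Lemma size_unmoved u w k : (k <= r.+1)%N -> size (unmoved u w k) = (k - #|moved u w k|)%N.
Proof.
move=> kr; have -> : size (unmoved u w k) = #|[pred i in unmoved u w k]|.
  by rewrite (card_uniqP _) // filter_uniq ?enum_uniq.
rewrite -{2}(card_positions_below kr) -(cardsID (moved u w k) (positions_below r k)).
have -> : positions_below r k :&: moved u w k = moved u w k.
  by apply/setIidPr/subsetP => i; rewrite !inE => /andP[].
rewrite addKn; apply: eq_card => i; rewrite inE mem_unmoved movedE !inE.
by case: (i < k)%N; rewrite ?andbF ?andbT ?negbK.
Qed.

(** The 0-based value of a position counts the positions below it: here the moved ones, counted by
    lambda, and the j earlier unmoved ones. *)
Lemma nth_unmoved u w k (j : nat) : (j < size (unmoved u w k))%N ->
  nth ord0 (unmoved u w k) j =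
    (#|[set i in moved u w k | (i < nth ord0 (unmoved u w k) j)%N]| + j)%N :> nat.
Proof.
set us := unmoved u w k => lt_j; set x := nth ord0 us j.
have xus : x \in us by apply: mem_nth.
have lt_us a b : (a < b)%N -> (b < size us)%N -> (nth ord0 us a < nth ord0 us b)%N.
  move=> ab bs; have := sorted_ltn_nth ltn_trans 0%N (unmoved_sorted u w k).
  move=> /(_ a b); rewrite !inE size_map -/us => /(_ (ltn_trans ab bs) bs ab).
  by rewrite !(nth_map ord0) //; apply: ltn_trans bs.
have lt_usE a b : (a < size us)%N -> (b < size us)%N ->
    (nth ord0 us a < nth ord0 us b)%N = (a < b)%N.
  move=> al bl; have [ab|ba|->] := ltngtP a b; first by rewrite lt_us.
    by rewrite ltnNge ltnW ?lt_us.
  by rewrite ltnn.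
have xk : (x < k)%N by move: xus; rewrite mem_unmoved => /andP[].
rewrite -{1}(card_positions_below (ltnW (ltn_ord x))) -(cardsID (moved u w k)); congr (_ + _)%N.
  by apply: eq_card => i; rewrite !inE andbC.
have us_uniq : uniq us by rewrite filter_uniq ?enum_uniq.
transitivity #|[pred i in take j us]|; last first.
  by rewrite (card_uniqP _) ?take_uniq // size_takel // ltnW.
apply: eq_card => i; rewrite inE [RHS]inE [X in _ && X]inE.
have -> : (i \notin moved u w k) && (i < x)%N = (i \in us) && (i < x)%N.
  rewrite mem_unmoved movedE inE; case: (ltnP i x) => ix; rewrite ?andbF // !andbT.
  by rewrite (ltn_trans ix xk) /= negbK.
have [ius|nus] := boolP (i \in us); last by apply/esym/negbTE; apply: contra nus => /mem_take.
by rewrite in_take // -(lt_usE (index i us) j) ?index_mem // nth_index.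
Qed.

(** In 0-based terms, pi_a with a > j + 1 only moves points from a - 1 on and fixes j; pi_{j+1}
    carries j to r_{k-p-j}; the earlier factors only reach smaller unmoved positions and fix that
    point. *)
Lemma v_elt_unmoved u w k (j : 'I_r.+1) : (k <= r.+1)%N ->
  (j < k - #|moved u w k|)%N -> v_elt u w k j = w (nth ord0 (unmoved u w k) j).
Proof.
move=> kr lt_j; set N := (k - _)%N in lt_j; set us := unmoved u w k.
have sz : size us = N by apply: size_unmoved.
have lamE a : (0 < a <= N)%N -> (lam u w k (N - a + 1) + a.-1)%N = nth ord0 us a.-1 :> nat.
  move=> aN; have lt_a : (a.-1 < size us)%N by rewrite sz; lia.
  rewrite (@nth_unmoved u w k _ lt_a) /lam /unmoved_seq -/(unmoved u w k) -/us; congr (_ + _)%N.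
  apply: eq_card => i; rewrite !inE nth_rev ?sz; last by lia.
  by congr (_ && (_ < nat_of_ord (nth _ _ _))%N); lia.
have pi_start a x : (0 < a <= N)%N -> x = a.-1 :> nat -> pi_elt u w k a x = nth ord0 us a.-1.
  move=> aN xa; apply: ord_inj; rewrite /pi_elt -/N (word_rev_iota_start _ _ xa); try lia.
    by rewrite addnC lamE.
  by have := lamE a aN; have := ltn_ord (nth ord0 us a.-1); lia.
have pi_fix a x : (0 < a <= N)%N -> (x < a.-1)%N || (nth ord0 us a.-1 < x)%N -> pi_elt u w k a x = x.
  move=> aN xa; have := lamE a aN; have := ltn_ord (nth ord0 us a.-1) => lt1 E.
  rewrite /pi_elt -/N word_rev_iota_fix //; lia.
rewrite /v_elt compWE -/N; congr (w _).
have -> : iota 1 N = iota 1 j ++ j.+1 :: iota j.+2 (N - j.+1).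
  rewrite -[j.+1 :: _]/(iota (1 + j) (N - j.+1).+1) -iotaD; congr iota; lia.
have fix_late : prodW [seq pi_elt u w k a | a <- iota j.+2 (N - j.+1)] j = j.
  have fix_a (a : nat) : a \in iota j.+2 (N - j.+1) -> pi_elt u w k a j = j.
    by rewrite mem_iota => a_in; apply: pi_fix; lia.
  by apply: prodW_fix => t /mapP[a /fix_a fix_j ->].
have fix_early : prodW [seq pi_elt u w k a | a <- iota 1 j] (nth ord0 us j) = nth ord0 us j.
  have fix_a (a : nat) : a \in iota 1 j -> pi_elt u w k a (nth ord0 us j) = nth ord0 us j.
    rewrite mem_iota => a_in; apply: pi_fix; first lia.
    have := sorted_ltn_nth ltn_trans 0%N (unmoved_sorted u w k).
    move=> /(_ a.-1 j); rewrite !inE size_map -/us sz !(nth_map ord0) ?sz; try lia.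
    by move=> lt_us; apply/orP; right; apply: lt_us; lia.
  by apply: prodW_fix => t /mapP[a /fix_a fix_j ->].
by rewrite map_cat prodW_cat compWE /= compWE fix_late pi_start //; lia.
Qed.

Lemma prod_v_elt (A : comNzRingType) (f : 'I_r.+1 -> A) u w k : (k <= r.+1)%N ->
  \prod_(j in positions_below r (k - #|moved u w k|)) f (v_elt u w k j) =
  \prod_(i in positions_below r k | u i == w i) f (w i).
Proof.
move=> kr; set us := unmoved u w k; set N := (k - _)%N.
have sz : size us = N by apply: size_unmoved.
have Nr : (N <= r.+1)%N by apply: leq_trans kr; apply: leq_subr.
transitivity (\prod_(i <- us) f (w i)).
  rewrite (big_nth ord0) big_mkord sz (eq_bigl (fun j : 'I_r.+1 => j < N)%N) => [|j]; last by rewrite inE.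
  rewrite (big_ord_narrow Nr); apply: eq_bigr => j _.
  by rewrite v_elt_unmoved /=.
rewrite big_uniq /=; last exact/filter_uniq/enum_uniq.
by apply: eq_bigl => i; rewrite mem_unmoved !inE.
Qed.

End SpecialElements.

(** * Newton expansion *)

Section Newton.
Variables (r : nat) (A : idomainType) (y : 'I_r.+1 -> A).
Local Notation W := 'S_r.+1.
Implicit Types (x : W) (a b i : 'I_r.+1) (k m d : nat).

Definition newton d : {poly A} := \prod_(i in positions_below r d) ('X - (y i)%:P).

Lemma newtonE d : newton d = \prod_(i <- enum (positions_below r d)) ('X - (y i)%:P).
Proof. by rewrite big_enum. Qed.

Lemma newton_monic d : newton d \is monic.
Proof. by rewrite newtonE monic_prod_XsubC. Qed.

Lemma size_newton d : (d <= r.+1)%N -> size (newton d) = d.+1.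
Proof. by move=> dr; rewrite newtonE size_prod_XsubC -cardE card_positions_below. Qed.

(** The polynomials are monic of distinct degrees as long as d does not exceed the number r + 1 of
    positions; hence the bound on n. *)
Lemma newton_free n (c : nat -> A) : (n <= r.+2)%N ->
  \sum_(d < n) (c d)%:P * newton d = 0 -> forall d, (d < n)%N -> c d = 0.
Proof.
elim: n => // n IHn nr; rewrite big_ord_recr /= => S0.
have cn : c n = 0.
  have /(congr1 (fun p : {poly A} => p`_n)) := S0.
  rewrite coef0 coefD coefCM coef_sum big1 ?add0r => [|d _].
    have <- : lead_coef (newton n) = (newton n)`_n by rewrite lead_coefE size_newton.
    by rewrite (monicP (newton_monic n)) mulr1.
  by rewrite coefCM nth_default ?mulr0 // size_newton //; have := ltn_ord d; lia.
move: S0; rewrite cn polyC0 mul0r addr0 => S0 d; rewrite ltnS leq_eqVlt => /predU1P[->//|dn].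
exact: IHn (ltnW nr) S0 _ dn.
Qed.

Lemma prod_XsubC_invariant a b k x : b = a.+1 :> nat -> b != k :> nat ->
  \prod_(i in positions_below r k) ('X - (y ((x *o tperm a b) i))%:P) =
  \prod_(i in positions_below r k) ('X - (y (x i))%:P).
Proof.
move=> ba bk; rewrite [RHS](reindex_inj (@perm_inj _ (tperm a b))) /=.
apply: eq_big => [i|i _]; last by rewrite compWE.
by rewrite !inE; case: tpermP => [->|->|//]; lia.
Qed.

Lemma prod_XsubC_adj a b x : b = a.+1 :> nat ->
  \prod_(i in positions_below r b) ('X - (y ((x *o tperm a b) i))%:P) =
  \prod_(i in positions_below r b) ('X - (y (x i))%:P)
  + (y (x a) - y (x b))%:P * \prod_(i in positions_below r a) ('X - (y (x i))%:P).
Proof.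
move=> ba; rewrite ba positions_below_succ !big_setU1 ?inE ?ltnn //=.
rewrite prod_XsubC_invariant //; last by lia.
rewrite compWE tpermL -mulrDl; congr (_ * _).
by rewrite rmorphB /= addrA subrK.
Qed.

(** The hypotheses list what is used of F(k,m,x) = xi^{c[k,m]}(x). At e only m = 0 survives and both
    sides agree. A simple reflection other than s_k changes neither side, and s_k adds to both a
    root times the product for k - 1. *)
Lemma prod_newton (F : nat -> nat -> W -> A) k x :
    (forall k x, F k 0%N x = 1) ->
    (forall k m, (m <= k < r)%N -> F k.+1 m.+1 1%g = 0) ->
    (forall k m a b x, b = a.+1 :> nat -> b != k :> nat -> (m <= k <= r)%N ->
       F k m (x *o tperm a b) = F k m x) ->
    (forall k m a b x, b = a.+1 :> nat -> a = k :> nat -> (m <= k)%N ->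
       F k.+1 m.+1 (x *o tperm a b) = F k.+1 m.+1 x + (y (x a) - y (x b)) * F k m x) ->
    (k <= r)%N ->
  \prod_(i in positions_below r k) ('X - (y (x i))%:P) =
    \sum_(m < k.+1) (F k m x)%:P * newton (k - m).
Proof.
move=> F0 F1 F_inv F_adj; elim: k x => [|k IHk] x kr.
  have E0 : positions_below r 0 = set0 by apply/setP => i; rewrite !inE.
  by rewrite big_ord1 F0 mul1r /newton E0 !big_set0.
apply/eqP; rewrite -subr_eq0; apply/eqP; move: x.
apply: (@adj_invariant_eq0 _ _ (fun x : W => \prod_(i in positions_below r k.+1) ('X - (y (x i))%:P) -
   \sum_(m < k.+2) (F k.+1 m x)%:P * newton (k.+1 - m))) => [a b x ba|]; last first.
  rewrite big_ord_recl F0 mul1r [X in _ - (_ + X)]big1 ?addr0 => [|m _].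
    by apply/eqP; rewrite subn0 subr_eq0; apply/eqP; apply: eq_bigr => i _; rewrite perm1.
  by rewrite lift0 F1 ?mul0r // -ltnS ltn_ord.
have [bk|bk] := eqVneq (b : nat) k.+1; last first.
  rewrite (prod_XsubC_invariant _ ba) //; congr (_ - _); apply: eq_bigr => m _.
  by rewrite F_inv //; have := ltn_ord m; lia.
have ak : a = k :> nat by lia.
rewrite -[in positions_below _ _]bk prod_XsubC_adj // [in RHS]bk -bk ak IHk ?(ltnW kr) // bk.
rewrite !(big_ord_recl k.+1) !F0 mulr_sumr.
have -> : \sum_(m < k.+1) (F k.+1 (lift ord0 m) (x *o tperm a b))%:P * newton (k.+1 - lift ord0 m) =
   \sum_(m < k.+1) (F k.+1 (lift ord0 m) x)%:P * newton (k.+1 - lift ord0 m) +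
   \sum_(m < k.+1) (y (x a) - y (x b))%:P * ((F k m x)%:P * newton (k - m)).
  rewrite -big_split; apply: eq_bigr => m _ /=.
  by rewrite F_adj -?[(m <= k)%N]ltnS // rmorphD rmorphM /= mulrDl mulrA subSS.
by rewrite [1%:P * _ + (_ + _)]addrA opprD addrACA subrr addr0.
Qed.

End Newton.

Lemma sum_ord_shift (V : nmodType) (H : nat -> V) p k : (p <= k)%N ->
  \sum_(m < (k - p).+1) H m = \sum_(m < k.+1) (if (p <= m)%N then H (m - p)%N else 0).
Proof.
move=> pk; pose G m := if (p <= m)%N then H (m - p)%N else 0.
rewrite -(big_mkord predT) -(big_mkord predT G) [RHS](big_cat_nat (n := p)) ?leqW //=.
have -> : \sum_(0 <= m < p) G m = 0.
  by rewrite big_nat big1 // => m /andP[_ mp]; rewrite /G leqNgt mp.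
rewrite add0r -{2}[p]add0n big_addn subSn //; apply: eq_big_nat => m _.
by rewrite /G leq_addl addnK.
Qed.

Lemma newton_coef_inj r (A : idomainType) (y : 'I_r.+1 -> A) k (a b : nat -> A) : (k <= r.+1)%N ->
  \sum_(m < k.+1) (a m)%:P * newton y (k - m) = \sum_(m < k.+1) (b m)%:P * newton y (k - m) ->
  forall m, (m <= k)%N -> a m = b m.
Proof.
move=> kr /eqP; rewrite -subr_eq0 -sumrB (reindex_inj rev_ord_inj) => /eqP S0 m mk.
apply/eqP; rewrite -subr_eq0 -[m](subKn mk); apply/eqP.
apply: (@newton_free r A y k.+1 (fun d => a (k - d)%N - b (k - d)%N)); rewrite ?ltnS ?leq_subr //.
rewrite -[RHS]S0; apply: eq_bigr => d _ /=.
have dk : (d <= k)%N by rewrite -ltnS.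
by rewrite !subSS (subKn dk) -mulrBl rmorphB.
Qed.

(** * Comparison of Newton coefficients *)

Section Final.
Variables (R : realType) (r : nat).
Local Notation W := 'S_r.+1.
Implicit Types (w u x : W) (a b i j q : 'I_r.+1) (k m d : nat).
Local Notation L i := (@FracField.tofrac (Sring R r) (Lcoord R i)).
Local Notation linf := (@linf R r).
Variables (xi : W -> Omega R r) (hxi : schubert_basis xi).

Lemma prod_linf_newton k x : (k <= r)%N ->
  \prod_(i in positions_below r k) linf (x i) =
    \sum_(m < k.+1) (xi (c_elt r k m) x)%:P * newton (fun i => L i) (k - m).
Proof.
apply: (@prod_newton r _ (fun i => L i) (fun k m x => xi (c_elt r k m) x)).
- by move=> k0 x0; rewrite c_elt0 (xi1 hxi).
- move=> k0 m /andP[mk kr]; apply: (xi_id hxi); apply/eqP => c1.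
  have lt_k : (k0 < r.+1)%N by apply: ltnW.
  have := @c_elt_desc r k0.+1 m.+1 (Ordinal lt_k) (Ordinal (kr : k0.+1 < r.+1)%N).
  by rewrite c1 !perm1 /= => /(_ erefl mk erefl kr); rewrite ltnNge leqnSn.
- move=> k0 m a b x0 ba bk /andP[mk kr]; apply/eqP; rewrite -subr_eq0 (xi_adj hxi) //.
  by rewrite ltnNge ltnW ?mulr0 // c_elt_asc.
move=> k0 m a b x0 ba ak mk; have lt_b := ltn_ord b.
have bk : b = k0.+1 :> nat by rewrite ba ak.
have kr : (k0.+1 <= r)%N by rewrite -bk -ltnS.
apply/eqP; rewrite -subr_eq0 opprD addrA (xi_adj hxi) //.
rewrite (c_elt_desc ba _ bk kr) // -{1}(sref_adj ba) ak c_elt_succ //.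
by rewrite -compWA -ak (sref_adj ba) /compW tperm2 mul1g subrr.
Qed.

Lemma linf_xi_expand k w x : (k <= r.+1)%N ->
  (\prod_(i in positions_below r k) linf (x i)) * (xi w x)%:P =
  \sum_(u | `[< superior_in (positions_from r k) (positions_below r k) w u >])
    (\prod_(i in positions_below r k | u i == w i) linf (w i)) * (xi u x)%:P.
Proof.
move=> kr; have xiE u : xi_at xi x u = (xi u x)%:P by rewrite ffunE.
transitivity (pieri linf (positions_from r k) (positions_below r k) (xi_at xi x) w).
  by rewrite -(prod_xi_at hxi x kr) ffunE -xiE.
rewrite pieri_expand ?positions_from_uniq //; last exact: precede_positions.
by apply: eq_bigr => u _; congr (_ * _); apply: xiE.
Qed.

(** Here p is the number of moved positions. The value 0 for m < p reflects that a product of k - p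
    linear factors has no component along N_{k-m}, whose degree is larger. *)
Definition pieri_coef k w u m : {fraction Sring R r} :=
  if (#|moved u w k| <= m)%N
  then xi (c_elt r (k - #|moved u w k|) (m - #|moved u w k|)) (v_elt u w k) else 0.

Lemma card_moved_le u w k : (k <= r.+1)%N -> (#|moved u w k| <= k)%N.
Proof.
move=> kr; rewrite -{2}(card_positions_below kr); apply: subset_leq_card.
by apply/subsetP => i; rewrite !inE => /andP[].
Qed.

Lemma unmoved_newton k w u : (k <= r)%N ->
  \prod_(i in positions_below r k | u i == w i) linf (w i) =
  \sum_(m < k.+1) (pieri_coef k w u m)%:P * newton (fun i => L i) (k - m).
Proof.
move=> kr; rewrite -(prod_v_elt linf) ?(leqW kr) //.
rewrite prod_linf_newton ?(leq_trans (leq_subr _ _) kr) //.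
set p := #|moved u w k|; have pk : (p <= k)%N := card_moved_le u w (leqW kr).
pose H m := (xi (c_elt r (k - p) m) (v_elt u w k))%:P * newton (fun i => L i) (k - p - m).
rewrite (@sum_ord_shift _ H) //; apply: eq_bigr => m _; rewrite /H /pieri_coef -/p.
case: ifP => pm; last by rewrite polyC0 mul0r.
by rewrite subnBA // subnK.
Qed.

Lemma superior_setE k w u p : (k <= r.+1)%N ->
  (u \in superior_set k p w) =
  `[< superior_in (positions_from r k) (positions_below r k) w u >] && (p == #|moved u w k|).
Proof.
move=> kr; rewrite inE; apply/asboolP/andP => [/superiorP[su El]|[/asboolP su /eqP ->]].
  split; first exact/asboolP.
  rewrite -(eqn_add2l (coxlen w)) -El movedE.
  rewrite (superior_in_coxlen (@precede_positions r k) (positions_from_uniq _ _) su) eqn_add2l.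
  by apply/eqP/eq_card => i; rewrite !inE.
apply/superiorP; split=> //.
rewrite (superior_in_coxlen (@precede_positions r k) (positions_from_uniq _ _) su).
by congr (_ + _)%N; apply: eq_card => i; rewrite movedE !inE.
Qed.

(** For a superior u the degree p is the number of moved positions, so each u occurs for at most one
    p. *)
Lemma sum_superior_set (V : nmodType) (G : nat -> W -> V) k w m : (k <= r.+1)%N ->
  \sum_(p < m.+1) \sum_(u in superior_set k p w) G p u =
  \sum_(u | `[< superior_in (positions_from r k) (positions_below r k) w u >])
    (if (#|moved u w k| <= m)%N then G #|moved u w k| u else 0).
Proof.
move=> kr; under eq_bigr => p _ do rewrite big_mkcond.
rewrite exchange_big [RHS]big_mkcond; apply: eq_bigr => u _ /=.
under eq_bigr => p _ do rewrite superior_setE //.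
case: asboolP => _ /=; last by rewrite big1.
by rewrite -big_mkcond (big_ord1_eq _ (fun p => G p u)) ltnS.
Qed.

Lemma pieri_at k m w x : (m <= k)%N -> (k <= r)%N ->
  xi (c_elt r k m) x * xi w x =
  \sum_(u | `[< superior_in (positions_from r k) (positions_below r k) w u >])
    pieri_coef k w u m * xi u x.
Proof.
(* All m are treated together: the two sides become the coefficients of N_{k-m} in one
   polynomial. *)
move=> mk kr; move: m mk; apply: (newton_coef_inj (y := fun i => L i) (leqW kr)).
transitivity ((\prod_(i in positions_below r k) linf (x i)) * (xi w x)%:P).
  rewrite prod_linf_newton // mulr_suml; apply: eq_bigr => m _.
  by rewrite polyCM mulrAC.
rewrite linf_xi_expand ?(leqW kr) //.
under eq_bigr => u _ do rewrite unmoved_newton // mulr_suml.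
rewrite exchange_big /=; apply: eq_bigr => m _.
rewrite rmorph_sum mulr_suml; apply: eq_bigr => u _ /=.
by rewrite polyCM mulrAC.
Qed.

End Final.

Theorem theorem1 (R : realType) (r k m : nat) (hr : (2 <= r.+1)%N)
    (hm : (1 <= m <= k)%N) (hk : (k <= r)%N)
    (xi : 'S_r.+1 -> Omega R r) (hxi : schubert_basis xi) (w : 'S_r.+1) :
  xi (c_elt r k m) * xi w =
    \sum_(p < m.+1) \sum_(u in superior_set k p w)
      xi (c_elt r (k - p) (m - p)) (v_elt u w k) *: xi u.
Proof.
case/andP: hm => _ mk; apply/ffunP => x.
rewrite (sum_superior_set (fun p u =>
  xi (c_elt r (k - p) (m - p)) (v_elt u w k) *: xi u) _ _ (leqW hk)).
rewrite sum_ffunE ffunE [LHS](pieri_at hxi w x mk hk); apply: eq_bigr => u _.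
by rewrite /pieri_coef; case: ifP; rewrite ffunE ?mul0r.
Qed.
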